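(* Let $K\ge 1$ and let $f=h+\overline{g}$ be a $K$-quasiconformal harmonic self mapping of the unit disc $\mathbb{D}$, where $h$ and $g$ are analytic in $\mathbb{D}$ and given by $$h(z)=\sum_{n=1}^{\infty} a_n z^n \quad\text{and}\quad g(z)=\sum_{n=1}^{\infty} b_n z^n,\qquad z\in\mathbb{D}.$$ Then for all $n=1,2,\ldots$ $$|a_n|\le \frac{K^{3K}\,2^{5\left(K-\frac1K\right)/2}}{n}\quad\text{and}\quad |b_n|\le \frac{K^{3K}\,2^{5\left(K-\frac1K\right)/2}}{n}.$$
   Context: $\mathbb{D}=\{z\in\mathbb{C}:|z|<1\}$. A complex-valued function $f=u+iv$ is harmonic if $u$ and $v$ are real-valued harmonic functions. For a continuously differentiable $f$, put $\Lambda_f=|f_z|+|f_{\bar z}|$, $\lambda_f=\big||f_z|-|f_{\bar z}|\big|$, and $J_f=|f_z|^2-|f_{\bar z}|^2$ (the Jacobian). A harmonic function $f$ is sense-preserving if $J_f(z)>0$ in its domain. A sense-preserving harmonic mapping $f$ is $K$-quasiregular ($K\ge1$) if $\Lambda_f^2\le K J_f$, equivalently $\Lambda_f\le K\lambda_f$, everywhere on its domain. A $K$-quasiregular harmonic mapping $f:G\to G'$ that is a homeomorphism of $G$ onto $G'$ is called a $K$-quasiconformal harmonic mapping; a $K$-quasiconformal harmonic self mapping of $\mathbb{D}$ is the case $G=G'=\mathbb{D}$. *)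

(* Defs.v *)
From Stdlib Require Export Reals.
From Coquelicot Require Export Coquelicot.
Open Scope R_scope.

Definition unit_disc (z : C) : Prop := Cmod z < 1.

Definition dx (u : C -> R) (z : C) : R := Derive (fun t : R => u (t, Im z)) (Re z).
Definition dy (u : C -> R) (z : C) : R := Derive (fun t : R => u (Re z, t)) (Im z).

(* [Derive] is total (with a junk value where the derivative does not exist), so
   existence of the partial derivatives is required separately. *)
Definition C1_on (G : C -> Prop) (u : C -> R) : Prop :=
  forall z : C, G z ->
    ex_derive (fun t : R => u (t, Im z)) (Re z) /\
    ex_derive (fun t : R => u (Re z, t)) (Im z) /\
    continuous (dx u) z /\
    continuous (dy u) z.

Definition C2_on (G : C -> Prop) (u : C -> R) : Prop :=
  C1_on G u /\ C1_on G (dx u) /\ C1_on G (dy u).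

Definition real_harmonic_on (G : C -> Prop) (u : C -> R) : Prop :=
  C2_on G u /\ forall z : C, G z -> dx (dx u) z + dy (dy u) z = 0.

Definition harmonic_on (G : C -> Prop) (f : C -> C) : Prop :=
  open G /\
  real_harmonic_on G (fun z => Re (f z)) /\
  real_harmonic_on G (fun z => Im (f z)).

Definition Cdx (f : C -> C) (z : C) : C :=
  (dx (fun w => Re (f w)) z, dx (fun w => Im (f w)) z).
Definition Cdy (f : C -> C) (z : C) : C :=
  (dy (fun w => Re (f w)) z, dy (fun w => Im (f w)) z).

(* Wirtinger derivatives f_z and f_{\bar z}. *)
Definition d_z (f : C -> C) (z : C) : C :=
  ((Cdx f z - Ci * Cdy f z) / RtoC 2)%C.
Definition d_zbar (f : C -> C) (z : C) : C :=
  ((Cdx f z + Ci * Cdy f z) / RtoC 2)%C.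

Definition Lambda (f : C -> C) (z : C) : R := Cmod (d_z f z) + Cmod (d_zbar f z).
Definition Jacobian (f : C -> C) (z : C) : R :=
  Cmod (d_z f z) ^ 2 - Cmod (d_zbar f z) ^ 2.

Definition sense_preserving_on (G : C -> Prop) (f : C -> C) : Prop :=
  forall z : C, G z -> 0 < Jacobian f z.

Definition quasiregular_harmonic_on (K : R) (G : C -> Prop) (f : C -> C) : Prop :=
  harmonic_on G f /\ sense_preserving_on G f /\
  forall z : C, G z -> Lambda f z ^ 2 <= K * Jacobian f z.

Definition homeomorphism_onto (G G' : C -> Prop) (f : C -> C) : Prop :=
  (forall z : C, G z -> G' (f z)) /\
  @continuous_on C_UniformSpace C_UniformSpace G f /\
  exists k : C -> C,
    (forall w : C, G' w -> G (k w)) /\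
    @continuous_on C_UniformSpace C_UniformSpace G' k /\
    (forall z : C, G z -> k (f z) = z) /\
    (forall w : C, G' w -> f (k w) = w).

Definition quasiconformal_harmonic (K : R) (G G' : C -> Prop) (f : C -> C) : Prop :=
  quasiregular_harmonic_on K G f /\ homeomorphism_onto G G' f.

Definition analytic_on (G : C -> Prop) (h : C -> C) : Prop :=
  forall z : C, G z -> @ex_derive C_AbsRing C_NormedModule h z.

(* Main.v *)
Require Import Defs.
From Stdlib Require Import Lra Lia Classical IndefiniteDescription Ranalysis5.

(* Each level curve gamma = f^{-1}(|w| = rho) is a closed C^1 curve in the disc, and
   omega := df = h' dz + conj (g' dz) has total mass 2 pi rho <= 2 pi along it.  Since f is
   quasiregular, |g' dz| and |h' dz| are at most K |omega|.  The curve gamma winds around 0 (by homotopy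
   from small rho, where f is close to its R-linear part), so up to the winding number
     2 pi i n a_n = int z^-n h' dz = int z^-n omega - int (z^-n - conj z^n) conj (g' dz),
   because z^n g' has a primitive.  As rho -> 1, properness of f gives |z| -> 1 uniformly on gamma,
   the last integral tends to 0 and |n a_n| <= 1; exchanging h and g, also |n b_n| <= 1.
   This is stronger than the claim, whose constant is at least 1.  The integrals along gamma
   can be replaced by primitives composed with gamma and the mean value inequality. *)

(** * Complex derivatives and curves *)

(** [gamma] is parametrised by the angle [t] of its image: [gamma(t) = k(rho e^(it))] with [k] the
    inverse of [f]. Then [omega] applied to the velocity is [i rho e^(it)], of modulus at most 1 at
    every [t], so a pointwise bound is enough. On a circle [|z| = r] no such bound on [df] is at
    hand. The price is that [k] is known only to be continuous. Differentiability of [gamma] comes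
    from the real-linear map [v -> h' v + conj (g' v)], invertible because [|g'| < |h'|]. The
    winding number is handled through a real function [theta], the integral of the angular velocity:
    its total increment has cosine 1, depends continuously on [rho] and is positive for small [rho],
    so it is at least [2 pi]. A lower bound is all that the estimate asks for, because the increment
    multiplies [n a_n] on the side to be bounded. *)

Lemma is_derive_iff_eps (K : AbsRing) (V : NormedModule K) (f : K -> V) (x : K) (l : V) :
  is_derive f x l <->
  forall eps : R, 0 < eps -> exists d : R, 0 < d /\
    forall y : K, abs (minus y x) < d ->
      norm (minus (minus (f y) (f x)) (scal (minus y x) l)) <= eps * abs (minus y x).
Proof.
  split.
  - intros [_ H] eps Heps.
    destruct (H x (fun P HP => HP) (mkposreal eps Heps)) as [d Hd].
    exists d; split; [apply cond_pos|exact Hd].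
  - intros H; split; [apply is_linear_scal_l|].
    intros x' Hx eps.
    replace x' with x by (apply (is_filter_lim_locally_unique (V := AbsRing_NormedModule K)); assumption).
    destruct (H eps (cond_pos eps)) as [d [Hd H']].
    exists (mkposreal d Hd). exact H'.
Qed.

Lemma is_derive_C_iff (f : C -> C) (z l : C) :
  @is_derive C_AbsRing C_NormedModule f z l <->
  forall eps : R, 0 < eps -> exists d : R, 0 < d /\
    forall w : C, Cmod (w - z) < d ->
      Cmod (f w - f z - (w - z) * l) <= eps * Cmod (w - z).
Proof. exact (is_derive_iff_eps C_AbsRing C_NormedModule f z l). Qed.

Lemma is_derive_R_iff (c : R -> R) (t v : R) :
  is_derive c t v <->
  forall eps : R, 0 < eps -> exists d : R, 0 < d /\
    forall s : R, Rabs (s - t) < d ->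
      Rabs (c s - c t - (s - t) * v) <= eps * Rabs (s - t).
Proof. exact (is_derive_iff_eps R_AbsRing R_NormedModule c t v). Qed.

Lemma is_derive_curve_iff (c : R -> C) (t : R) (v : C) :
  @is_derive R_AbsRing C_R_NormedModule c t v <->
  forall eps : R, 0 < eps -> exists d : R, 0 < d /\
    forall s : R, Rabs (s - t) < d ->
      Cmod (c s - c t - RtoC (s - t) * v) <= eps * Rabs (s - t).
Proof.
  assert (E : forall s, (c s - c t - RtoC (s - t) * v)%C =
     minus (minus (c s) (c t)) (@scal R_AbsRing C_R_NormedModule (s - t) v)).
  { intros s. apply injective_projections; cbn; unfold mult; cbn; ring. }
  rewrite (is_derive_iff_eps R_AbsRing C_R_NormedModule c t v).
  split; intros H eps Heps; destruct (H eps Heps) as [d [Hd H']];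
    exists d; (split; [exact Hd|]); intros s Hs; specialize (H' s Hs).
  - rewrite E, Cmod_norm. exact H'.
  - rewrite E, Cmod_norm in H'. exact H'.
Qed.

Lemma im_le_Cmod (z : C) : Rabs (Im z) <= Cmod z.
Proof. eapply Rle_trans; [apply Rmax_r|apply Rmax_Cmod]. Qed.

Lemma Cmod_le_Re_Im (z : C) : Cmod z <= Rabs (Re z) + Rabs (Im z).
Proof.
  rewrite <- (Cmod_R (Re z)), <- (Cmod_R (Im z)).
  replace (Cmod (RtoC (Im z))) with (Cmod (Ci * RtoC (Im z))) by (rewrite Cmod_mult, Cmod_Ci; ring).
  eapply Rle_trans; [|apply Cmod_triangle]. right; f_equal.
  apply injective_projections; cbn; unfold Re, Im; ring.
Qed.

Lemma is_derive_curve_components (c : R -> C) (t : R) (v : C) :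
  @is_derive R_AbsRing C_R_NormedModule c t v <->
  is_derive (fun s => Re (c s)) t (Re v) /\ is_derive (fun s => Im (c s)) t (Im v).
Proof.
  rewrite is_derive_curve_iff, !is_derive_R_iff.
  assert (ER : forall s, Re (c s - c t - RtoC (s - t) * v) = Re (c s) - Re (c t) - (s - t) * Re v)
    by (intros; unfold Re, Im; cbn; ring).
  assert (EI : forall s, Im (c s - c t - RtoC (s - t) * v) = Im (c s) - Im (c t) - (s - t) * Im v)
    by (intros; unfold Re, Im; cbn; ring).
  split.
  - intros H; split; intros eps Heps; destruct (H eps Heps) as [d [Hd H']];
      exists d; (split; [exact Hd|]); intros s Hs; specialize (H' s Hs);
      eapply Rle_trans; try exact H'.
    + rewrite <- ER; apply re_le_Cmod.
    + rewrite <- EI; apply im_le_Cmod.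
  - intros [H1 H2] eps Heps.
    destruct (H1 (eps / 2)) as [d1 [Hd1 H1']]; [lra|].
    destruct (H2 (eps / 2)) as [d2 [Hd2 H2']]; [lra|].
    exists (Rmin d1 d2); split; [now apply Rmin_pos|]. intros s Hs.
    eapply Rle_trans; [apply Cmod_le_Re_Im|]. rewrite ER, EI.
    pose proof (Rmin_l d1 d2); pose proof (Rmin_r d1 d2).
    specialize (H1' s ltac:(lra)); specialize (H2' s ltac:(lra)). lra.
Qed.

(** The outer derivative is over [C] and the inner one over [R]; the [Cmod] characterisations put
    both in the same terms. The remainder splits into the outer remainder at [c s] and [l] times the
    inner remainder, each allotted half of [eps]; [M] is a local Lipschitz constant of [c] at
    [t]. *)
Lemma is_derive_curve_comp (F : C -> C) (c : R -> C) (t : R) (l v : C) :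
  @is_derive C_AbsRing C_NormedModule F (c t) l ->
  @is_derive R_AbsRing C_R_NormedModule c t v ->
  @is_derive R_AbsRing C_R_NormedModule (fun s => F (c s)) t (l * v)%C.
Proof.
  intros HF Hc. rewrite is_derive_C_iff in HF. rewrite is_derive_curve_iff in Hc |- *.
  intros eps Heps.
  pose proof (Cmod_ge_0 l); pose proof (Cmod_ge_0 v).
  set (M := Cmod v + 1).
  destruct (HF (eps / (2 * M))) as [d1 [Hd1 H1]].
  { apply Rdiv_lt_0_compat; unfold M; lra. }
  destruct (Hc (Rmin 1 (eps / (2 * (Cmod l + 1))))) as [d2 [Hd2 H2]].
  { apply Rmin_pos; [lra|]. apply Rdiv_lt_0_compat; lra. }
  exists (Rmin d2 (d1 / M)); split.
  { apply Rmin_pos; [lra|]. apply Rdiv_lt_0_compat; unfold M; lra. }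
  intros s Hs.
  assert (Hs2 : Rabs (s - t) < d2) by (eapply Rlt_le_trans; [exact Hs|apply Rmin_l]).
  assert (Hs1 : Rabs (s - t) < d1 / M) by (eapply Rlt_le_trans; [exact Hs|apply Rmin_r]).
  specialize (H2 s Hs2).
  assert (Hp := Rabs_pos (s - t)).
  assert (Hlin : Cmod (c s - c t) <= M * Rabs (s - t)).
  { replace (c s - c t)%C with ((c s - c t - RtoC (s - t) * v) + RtoC (s - t) * v)%C by ring.
    eapply Rle_trans; [apply Cmod_triangle|]. rewrite Cmod_mult, Cmod_R.
    assert (Cmod (c s - c t - RtoC (s - t) * v) <= 1 * Rabs (s - t)).
    { eapply Rle_trans; [exact H2|]. apply Rmult_le_compat_r; [lra|apply Rmin_l]. }
    unfold M; lra. }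
  assert (HM : 0 < M) by (unfold M; lra).
  specialize (H1 (c s)).
  assert (Cmod (c s - c t) < d1).
  { eapply Rle_lt_trans; [exact Hlin|]. apply Rmult_lt_compat_l with (r := M) in Hs1; [|lra].
    replace (M * (d1 / M)) with d1 in Hs1 by (field; lra). lra. }
  specialize (H1 H3).
  replace (F (c s) - F (c t) - RtoC (s - t) * (l * v))%C with
    ((F (c s) - F (c t) - (c s - c t) * l) + l * (c s - c t - RtoC (s - t) * v))%C by ring.
  eapply Rle_trans; [apply Cmod_triangle|]. rewrite Cmod_mult.
  assert (A1 : eps / (2 * M) * Cmod (c s - c t) <= eps / 2 * Rabs (s - t)).
  { apply Rle_trans with (eps / (2 * M) * (M * Rabs (s - t))).
    - apply Rmult_le_compat_l; [|exact Hlin]. apply Rlt_le, Rdiv_lt_0_compat; lra.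
    - right; field; lra. }
  assert (A2 : Cmod l * Cmod (c s - c t - RtoC (s - t) * v) <= eps / 2 * Rabs (s - t)).
  { apply Rle_trans with ((Cmod l + 1) * (eps / (2 * (Cmod l + 1)) * Rabs (s - t))).
    - apply Rmult_le_compat; [lra|apply Cmod_ge_0|lra|].
      eapply Rle_trans; [exact H2|]. apply Rmult_le_compat_r; [lra|apply Rmin_r].
    - right; field; lra. }
  lra.
Qed.

Lemma is_derive_curve_conj (c : R -> C) (t : R) (v : C) :
  @is_derive R_AbsRing C_R_NormedModule c t v ->
  @is_derive R_AbsRing C_R_NormedModule (fun s => Cconj (c s)) t (Cconj v).
Proof.
  rewrite !is_derive_curve_components. intros [H1 H2]; split; [exact H1|].
  exact (is_derive_opp _ _ _ H2).
Qed.

(** The real mean value theorem is applied to [phi], the scalar product of [c] with the chord [X].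
    Its increment is [|X|^2] and its derivative is at most [|X| M], so one factor [|X|] cancels. *)
Lemma curve_mean_value (c v : R -> C) (x y M : R) :
  x < y ->
  (forall t, x <= t <= y -> @is_derive R_AbsRing C_R_NormedModule c t (v t)) ->
  (forall t, x <= t <= y -> Cmod (v t) <= M) ->
  Cmod (c y - c x) <= M * (y - x).
Proof.
  intros Hxy Hd HM. set (X := (c y - c x)%C).
  set (phi := fun t => Re X * Re (c t) + Im X * Im (c t)).
  destruct (MVT_cor2 phi (fun t => Re X * Re (v t) + Im X * Im (v t)) x y Hxy) as [xi [E Hxi]].
  { intros t Ht. apply is_derive_Reals. destruct (proj1 (is_derive_curve_components _ _ _) (Hd t Ht)) as [H1 H2].
    unfold phi. apply (is_derive_plus (fun t => Re X * Re (c t)) (fun t => Im X * Im (c t)));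
    apply is_derive_scal; assumption. }
  assert (E1 : phi y - phi x = Cmod X ^ 2).
  { rewrite Cmod2_alt. unfold phi, X, Re, Im; cbn; ring. }
  assert (E2 : Re X * Re (v xi) + Im X * Im (v xi) <= Cmod X * M).
  { replace (Re X * Re (v xi) + Im X * Im (v xi)) with (Re (Cconj X * v xi)) by (unfold Re, Im; cbn; ring).
    eapply Rle_trans; [apply Rle_abs|]. eapply Rle_trans; [apply re_le_Cmod|].
    rewrite Cmod_mult, Cmod_conj. apply Rmult_le_compat_l; [apply Cmod_ge_0|]. apply HM; lra. }
  destruct (Rle_lt_or_eq_dec _ _ (Cmod_ge_0 X)) as [Hpos|H0].
  - apply Rmult_le_reg_l with (Cmod X); [lra|].
    replace (Cmod X * Cmod X) with (Cmod X ^ 2) by ring. rewrite <- E1, E.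
    apply Rmult_le_compat_r with (r := y - x) in E2; lra.
  - rewrite <- H0. apply Rmult_le_pos; [|lra].
    eapply Rle_trans; [apply Cmod_ge_0|apply (HM x); lra].
Qed.

(** * Complex power series *)

Definition is_Cpseries (c : nat -> C) (z s : C) : Prop :=
  @is_series C_AbsRing C_NormedModule (fun m => (c m * z ^ m)%C) s.

Lemma is_Cseries_unique (a : nat -> C) (l1 l2 : C) :
  @is_series C_AbsRing C_NormedModule a l1 ->
  @is_series C_AbsRing C_NormedModule a l2 -> l1 = l2.
Proof.
  intros H1 H2.
  exact (@filterlim_locally_unique nat C_AbsRing C_NormedModule eventually _ (sum_n a) l1 l2 H1 H2).
Qed.

Lemma is_Cseries_le (a : nat -> C) (b : nat -> R) (l : C) (M : R) :
  @is_series C_AbsRing C_NormedModule a l -> is_series b M ->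
  (forall n, Cmod (a n) <= b n) -> Cmod l <= M.
Proof.
  intros Ha Hb Hle.
  assert (H := filterlim_comp _ _ _ _ _ _ _ _ Ha
    (@filterlim_norm C_AbsRing C_NormedModule l)).
  apply (is_lim_seq_le (fun n => Cmod (@sum_n C_AbelianGroup a n)) (sum_n b) (Cmod l) M); [|exact H|exact Hb].
  intros n. eapply Rle_trans; [exact (@norm_sum_n_m C_AbsRing C_NormedModule a 0 n)|].
  apply sum_n_m_le, Hle.
Qed.

Lemma is_Cseries_terms_bounded (a : nat -> C) (l : C) :
  @is_series C_AbsRing C_NormedModule a l -> exists M, forall n, Cmod (a n) <= M.
Proof.
  intros Ha.
  destruct (@Cauchy_ex_series C_AbsRing C_CompleteNormedModule a (ex_intro _ l Ha) (mkposreal 1 Rlt_0_1)) as [N HN].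
  assert (Hfin : forall k, exists M, forall n, (n < k)%nat -> Cmod (a n) <= M).
  { induction k as [|k [M HM]].
    - exists 0; intros n Hn; lia.
    - exists (Rmax M (Cmod (a k))). intros n Hn.
      destruct (Nat.eq_dec n k) as [->|Hne]; [apply Rmax_r|].
      eapply Rle_trans; [apply HM; lia|apply Rmax_l]. }
  destruct (Hfin N) as [M HM]. exists (Rmax M 1). intros n.
  destruct (Compare_dec.le_lt_dec N n) as [Hn|Hn].
  - eapply Rle_trans; [|apply Rmax_r].
    specialize (HN n n Hn Hn). rewrite sum_n_n in HN. apply Rlt_le; exact HN.
  - eapply Rle_trans; [now apply HM|apply Rmax_l].
Qed.

Definition converges_on_disc (c : nat -> C) : Prop :=
  forall z, unit_disc z -> exists s, is_Cpseries c z s.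

(** Convergence at the real point [r < 1] bounds the terms [c m * r ^ m]. Passing to the moduli of
    the coefficients makes the theory of real convergence radii, in particular under [PS_derive],
    available for complex series. *)
Lemma CV_radius_Cmod_ge_1 (c : nat -> C) :
  converges_on_disc c -> Rbar_le 1 (CV_radius (fun m => Cmod (c m))).
Proof.
  intros Hc. destruct (CV_radius_bounded (fun m => Cmod (c m))) as [Hub _].
  assert (Hr : forall r, 0 <= r < 1 -> Rbar_le r (CV_radius (fun m => Cmod (c m)))).
  { intros r Hr. apply Hub.
    assert (Hd : unit_disc (RtoC r)) by (unfold unit_disc; rewrite Cmod_R, Rabs_pos_eq; lra).
    destruct (Hc _ Hd) as [s Hs]. destruct (is_Cseries_terms_bounded _ _ Hs) as [M HM].
    exists M. intros n. specialize (HM n). rewrite Cmod_mult, Cmod_pow, Cmod_R, (Rabs_pos_eq r) in HM by lra.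
    rewrite Rabs_pos_eq; [exact HM|]. apply Rmult_le_pos; [apply Cmod_ge_0|apply pow_le; lra]. }
  destruct (CV_radius (fun m => Cmod (c m))) as [x| |] eqn:E.
  - cbn in Hr |- *. destruct (Rle_lt_dec 1 x); [assumption|].
    pose proof (Hr 0 ltac:(lra)). specialize (Hr ((x + 1) / 2)). lra.
  - exact I.
  - exfalso; exact (Hr 0 ltac:(lra)).
Qed.

Lemma ex_series_of_CV_radius (al : nat -> R) (r : R) :
  (forall m, 0 <= al m) -> Rbar_le 1 (CV_radius al) -> 0 <= r < 1 ->
  ex_series (fun m => al m * r ^ m).
Proof.
  intros Hal HR Hr.
  eapply ex_series_ext; [|apply (CV_disk_inside al r)].
  - intros n; cbn. rewrite Rabs_pos_eq; [reflexivity|].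
    apply Rmult_le_pos; [apply Hal|apply pow_le; lra].
  - rewrite Rabs_pos_eq by lra. eapply Rbar_lt_le_trans; [|exact HR]. cbn; lra.
Qed.

Lemma ex_Cseries_le (a : nat -> C) (b : nat -> R) :
  (forall n, Cmod (a n) <= b n) -> ex_series b ->
  exists s, @is_series C_AbsRing C_NormedModule a s.
Proof. intros H1 H2. exact (@ex_series_le C_AbsRing C_CompleteNormedModule a b H1 H2). Qed.

Lemma converges_on_disc_le (c d : nat -> C) (M : R) :
  converges_on_disc c -> (forall m, Cmod (d m) <= M * Cmod (c m)) -> converges_on_disc d.
Proof.
  intros Hc Hd z Hz.
  apply ex_Cseries_le with (fun m => M * (Cmod (c m) * Cmod z ^ m)).
  - intros n. rewrite Cmod_mult, Cmod_pow, <- Rmult_assoc.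
    apply Rmult_le_compat_r; [apply pow_le, Cmod_ge_0|apply Hd].
  - apply (@ex_series_scal R_AbsRing R_NormedModule M), ex_series_of_CV_radius.
    + intros; apply Cmod_ge_0.
    + now apply CV_radius_Cmod_ge_1.
    + split; [apply Cmod_ge_0|exact Hz].
Qed.

Lemma Cpseries_function (c : nat -> C) :
  converges_on_disc c -> exists S : C -> C, forall z, unit_disc z -> is_Cpseries c z (S z).
Proof.
  intros Hc. exists (fun z => @iota C_CompleteNormedModule (is_Cpseries c z)).
  intros z Hz. apply (@iota_correct C_AbsRing C_CompleteNormedModule).
  destruct (Hc z Hz) as [s Hs]. exists s; split; [exact Hs|].
  intros s' Hs'. exact (is_Cseries_unique _ _ _ Hs Hs').
Qed.

(** The factor in front of [|w - z|^2] is the shape of the [m]-th term of a twice derived power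
    series at [r], so these remainders can be summed. It is twice the sharp Taylor constant, which
    leaves slack in the induction. *)
Lemma Cpow_taylor2 (z w : C) (r : R) (m : nat) :
  Cmod z <= r -> Cmod w <= r ->
  Cmod (w ^ S (S m) - z ^ S (S m) - (w - z) * (INR (S (S m)) * z ^ S m))
    <= INR (S m) * (INR (S (S m)) * r ^ m) * Cmod (w - z) ^ 2.
Proof.
  intros Hz Hw. assert (Hr : 0 <= r) by (pose proof (Cmod_ge_0 z); lra).
  induction m as [|m IH].
  - replace (w ^ 2 - z ^ 2 - (w - z) * (INR 2 * z ^ 1))%C with ((w - z) * (w - z))%C by (cbn [INR]; rewrite RtoC_plus, !Cpow_S; cbn [Cpow]; ring).
    rewrite Cmod_mult. pose proof (pow2_ge_0 (Cmod (w - z))). cbn in *. lra.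
  - assert (E : (w ^ S (S (S m)) - z ^ S (S (S m)) - (w - z) * (INR (S (S (S m))) * z ^ S (S m))
      = w * (w ^ S (S m) - z ^ S (S m) - (w - z) * (INR (S (S m)) * z ^ S m))
        + INR (S (S m)) * z ^ S m * ((w - z) * (w - z)))%C).
    { rewrite (S_INR (S (S m))), RtoC_plus. rewrite !Cpow_S. ring. }
    rewrite E. eapply Rle_trans; [apply Cmod_triangle|].
    rewrite !Cmod_mult, Cmod_R, Cmod_pow, (Rabs_pos_eq (INR _)) by apply pos_INR.
    set (D := Cmod (w - z)) in *.
    assert (HD : 0 <= D) by apply Cmod_ge_0.
    assert (H1 : Cmod w * Cmod (w ^ S (S m) - z ^ S (S m) - (w - z) * (INR (S (S m)) * z ^ S m))
      <= r * (INR (S m) * (INR (S (S m)) * r ^ m) * D ^ 2)).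
    { apply Rmult_le_compat; try apply Cmod_ge_0; assumption. }
    assert (H2 : Cmod z ^ S m <= r ^ S m) by (apply pow_incr; split; [apply Cmod_ge_0|assumption]).
    assert (H3 : INR (S (S m)) * Cmod z ^ S m * (D * D) <= INR (S (S m)) * r ^ S m * (D * D)).
    { apply Rmult_le_compat_r; [nra|]. apply Rmult_le_compat_l; [apply pos_INR|exact H2]. }
    eapply Rle_trans; [apply Rplus_le_compat; [exact H1|exact H3]|].
    assert (Hpos : 0 <= r ^ S m * (D * D)) by (apply Rmult_le_pos; [now apply pow_le|nra]).
    replace (r * (INR (S m) * (INR (S (S m)) * r ^ m) * D ^ 2) + INR (S (S m)) * r ^ S m * (D * D))
      with (INR (S (S m)) * (INR (S m) + 1) * (r ^ S m * (D * D))) by (cbn [pow]; ring).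
    replace (INR (S (S m)) * (INR (S (S (S m))) * r ^ S m) * D ^ 2)
      with (INR (S (S m)) * INR (S (S (S m))) * (r ^ S m * (D * D))) by ring.
    apply Rmult_le_compat_r; [exact Hpos|]. apply Rmult_le_compat_l; [apply pos_INR|].
    rewrite (S_INR (S (S m))), (S_INR (S m)). lra.
Qed.

(** The remainder of [P] at [z] is the sum of the remainders of its monomials. These are dominated
    by the twice derived series of the moduli, whose sum [M] at a radius [r] between [|z|] and 1
    gives a remainder of at most [M |w - z|^2]. *)
Lemma Cpseries_derive (c : nat -> C) (P : C -> C) :
  (forall z, unit_disc z -> is_Cpseries c z (P z)) ->
  forall z, unit_disc z ->
    @is_derive C_AbsRing C_NormedModule P z (C_derive P z) /\
    is_Cpseries (fun m => (INR (S m) * c (S m))%C) z (C_derive P z).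
Proof.
  intros HP z Hz.
  set (al := fun m => Cmod (c m)).
  assert (HR : Rbar_le 1 (CV_radius al)).
  { apply CV_radius_Cmod_ge_1. intros w Hw. exists (P w). now apply HP. }
  assert (Hal : forall m, 0 <= PS_derive al m).
  { intros m. apply Rmult_le_pos; [apply pos_INR|apply Cmod_ge_0]. }
  assert (Hal2 : forall m, 0 <= PS_derive (PS_derive al) m).
  { intros m. apply Rmult_le_pos; [apply pos_INR|apply Hal]. }
  unfold unit_disc in Hz. pose proof (Cmod_ge_0 z) as Hz0.
  destruct (ex_Cseries_le (fun m => ((INR (S m) * c (S m)) * z ^ m)%C)
    (fun m => PS_derive al m * Cmod z ^ m)) as [D HD].
  { intros n. rewrite !Cmod_mult, Cmod_pow, Cmod_R, Rabs_pos_eq by apply pos_INR.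
    apply Rle_refl. }
  { apply ex_series_of_CV_radius; [exact Hal|now rewrite CV_radius_derive|lra]. }
  assert (HDer : @is_derive C_AbsRing C_NormedModule P z D).
  2: { rewrite (is_C_derive_unique P z D HDer). split; assumption. }
  set (r := (1 + Cmod z) / 2). assert (Hr : Cmod z < r < 1) by (unfold r; lra).
  destruct (ex_series_of_CV_radius (PS_derive (PS_derive al)) r Hal2) as [M HM].
  { now rewrite !CV_radius_derive. }
  { lra. }
  assert (Hrem : forall w, Cmod w <= r -> Cmod (P w - P z - (w - z) * D) <= M * Cmod (w - z) ^ 2).
  { intros w Hw. assert (Hwd : unit_disc w) by (unfold unit_disc; lra).
    assert (Hsum : @is_series C_AbsRing C_NormedModule
      (fun m => (c m * (w ^ m - z ^ m - (w - z) * (INR m * z ^ pred m)))%C)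
      (P w - P z - (w - z) * D)%C).
    { assert (HDs : @is_series C_AbsRing C_NormedModule
        (fun m => ((INR m * c m) * z ^ pred m)%C) D).
      { apply is_series_decr_1.
        match goal with |- is_series _ ?l => replace l with D end; [exact HD|].
        apply injective_projections; cbn; ring. }
      assert (H1 := is_series_minus _ _ _ _ (HP w Hwd) (HP z Hz)).
      assert (H2 := is_series_minus _ _ _ _ H1 (is_series_scal (w - z)%C _ _ HDs)).
      eapply is_series_ext; [|exact H2]. intros m.
      change ((c m * w ^ m - c m * z ^ m - (w - z) * ((INR m * c m) * z ^ pred m))%C
        = (c m * (w ^ m - z ^ m - (w - z) * (INR m * z ^ pred m)))%C). ring. }
    (* The remainders of index 0 and 1 vanish (for index 0 the value [pred 0 = 0] is harmless, its
       factor [INR 0] being zero), so the sum may start at index 2, where [Cpow_taylor2] applies. *)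
    assert (Hsum2 : @is_series C_AbsRing C_NormedModule
      (fun m => (c (S (S m)) * (w ^ S (S m) - z ^ S (S m) - (w - z) * (INR (S (S m)) * z ^ S m)))%C)
      (P w - P z - (w - z) * D)%C).
    { apply (@is_series_incr_1 C_AbsRing C_NormedModule
        (fun m => (c (S m) * (w ^ S m - z ^ S m - (w - z) * (INR (S m) * z ^ m)))%C)).
      match goal with |- is_series _ ?l => replace l with (P w - P z - (w - z) * D)%C end.
      2: { change (P w - P z - (w - z) * D = P w - P z - (w - z) * D
             + c 1%nat * (w ^ 1 - z ^ 1 - (w - z) * (INR 1 * z ^ 0)))%C. cbn. ring. }
      apply (@is_series_incr_1 C_AbsRing C_NormedModule
        (fun m => (c m * (w ^ m - z ^ m - (w - z) * (INR m * z ^ pred m)))%C)).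
      match goal with |- is_series _ ?l => replace l with (P w - P z - (w - z) * D)%C end.
      2: { change (P w - P z - (w - z) * D = P w - P z - (w - z) * D
             + c 0%nat * (w ^ 0 - z ^ 0 - (w - z) * (INR 0 * z ^ 0)))%C. cbn. ring. }
      exact Hsum. }
    apply (is_Cseries_le _ _ _ (M * Cmod (w - z) ^ 2) Hsum2
      (is_series_scal_r (Cmod (w - z) ^ 2) _ _ HM)).
    intros n. rewrite Cmod_mult.
    eapply Rle_trans.
    - apply Rmult_le_compat_l; [apply Cmod_ge_0|].
      apply (Cpow_taylor2 z w r n); lra.
    - right. unfold PS_derive, al. ring. }
  assert (HM0 : 0 <= M).
  { apply (is_lim_seq_le (fun _ => 0) (sum_n (fun m => PS_derive (PS_derive al) m * r ^ m)) 0 M);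
      [|apply is_lim_seq_const|exact HM].
    intros n. rewrite sum_n_Reals. apply cond_pos_sum. intros k.
    apply Rmult_le_pos; [apply Hal2|apply pow_le; lra]. }
  apply is_derive_C_iff. intros eps Heps.
  exists (Rmin (r - Cmod z) (eps / (M + 1))); split.
  { apply Rmin_pos; [lra|]. apply Rdiv_lt_0_compat; lra. }
  intros w Hw.
  pose proof (Rmin_l (r - Cmod z) (eps / (M + 1))); pose proof (Rmin_r (r - Cmod z) (eps / (M + 1))).
  assert (Cmod w <= r).
  { replace w with (z + (w - z))%C by ring. eapply Rle_trans; [apply Cmod_triangle|]. lra. }
  eapply Rle_trans; [now apply Hrem|].
  replace (M * Cmod (w - z) ^ 2) with (M * Cmod (w - z) * Cmod (w - z)) by ring.
  apply Rmult_le_compat_r; [apply Cmod_ge_0|].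
  apply Rle_trans with ((M + 1) * (eps / (M + 1))); [|right; field; lra].
  apply Rmult_le_compat; try lra. apply Cmod_ge_0.
Qed.

(** The operator [z d/dz] keeps each power of [z] at its index, so the differential identities for
    primitives below reduce to comparing coefficients without any shift. *)
Lemma Cpseries_derive_mul (c : nat -> C) (P : C -> C) (z : C) :
  (forall z, unit_disc z -> is_Cpseries c z (P z)) -> unit_disc z ->
  is_Cpseries (fun m => (INR m * c m)%C) z (z * C_derive P z)%C.
Proof.
  intros HP Hz. destruct (Cpseries_derive c P HP z Hz) as [_ HD].
  apply is_series_decr_1.
  match goal with |- is_series _ ?l => replace l with (z * C_derive P z)%C end.
  2: { change (z * C_derive P z = z * C_derive P z + - (INR 0 * c 0%nat * z ^ 0))%C. cbn; ring. }
  eapply is_series_ext; [|exact (is_series_scal z _ _ HD)].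
  intros m. change (z * (INR (S m) * c (S m) * z ^ m) = INR (S m) * c (S m) * z ^ S m)%C.
  rewrite Cpow_S. ring.
Qed.

Lemma is_Cpseries_monomial (n : nat) (x z : C) :
  is_Cpseries (fun m => if Nat.eq_dec m n then x else 0) z (x * z ^ n)%C.
Proof.
  unfold is_Cpseries, is_series.
  apply filterlim_ext_loc with (fun _ => (x * z ^ n)%C); [|apply filterlim_const].
  exists n.
  assert (Hlt : forall N, (N < n)%nat -> @sum_n C_AbelianGroup (fun m => ((if Nat.eq_dec m n then x else 0) * z ^ m)%C) N = RtoC 0).
  { induction N as [|N IH]; intros HN.
    - rewrite sum_O. destruct (Nat.eq_dec 0 n); [lia|]. apply Cmult_0_l.
    - rewrite sum_Sn, IH by lia. destruct (Nat.eq_dec (S N) n); [lia|].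
      change (0 + 0 * z ^ S N = 0)%C; ring. }
  induction 1 as [|N HN IH].
  - destruct n as [|n].
    + rewrite sum_O. destruct (Nat.eq_dec 0 0); [reflexivity|lia].
    + rewrite sum_Sn, Hlt by lia. destruct (Nat.eq_dec (S n) (S n)); [|lia].
      change (x * z ^ S n = 0 + x * z ^ S n)%C; ring.
  - rewrite sum_Sn, <- IH. destruct (Nat.eq_dec (S N) n); [lia|].
    change (x * z ^ n = x * z ^ n + 0 * z ^ S N)%C; ring.
Qed.

(* [C] carries two normed module structures over itself, which differ in their (equivalent)
   uniform structures; the library's product and chain rules use the first one. *)
Lemma is_derive_C_AbsRing_iff (F : C -> C) (z l : C) :
  @is_derive C_AbsRing (AbsRing_NormedModule C_AbsRing) F z l <->
  @is_derive C_AbsRing C_NormedModule F z l.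
Proof.
  rewrite is_derive_C_iff. exact (is_derive_iff_eps C_AbsRing (AbsRing_NormedModule C_AbsRing) F z l).
Qed.

Lemma is_derive_Cmult (F G : C -> C) (z F' G' : C) :
  @is_derive C_AbsRing C_NormedModule F z F' ->
  @is_derive C_AbsRing C_NormedModule G z G' ->
  @is_derive C_AbsRing C_NormedModule (fun w => F w * G w)%C z (F' * G z + F z * G')%C.
Proof.
  rewrite <- !is_derive_C_AbsRing_iff. intros HF HG.
  exact (@is_derive_mult C_AbsRing F G z F' G' HF HG Cmult_comm).
Qed.

Lemma is_derive_Cpow (n : nat) (z : C) :
  @is_derive C_AbsRing C_NormedModule (fun w => (w ^ S n)%C) z (INR (S n) * z ^ n)%C.
Proof.
  assert (Hid : @is_derive C_AbsRing C_NormedModule (fun w => w) z (RtoC 1))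
    by (apply is_derive_C_AbsRing_iff; exact (@is_derive_id C_AbsRing z)).
  induction n as [|n IH].
  - replace (INR 1 * z ^ 0)%C with (RtoC 1) by (cbn; ring).
    apply (is_derive_ext (K := C_AbsRing) (V := C_NormedModule) (fun w => w)); [|exact Hid].
    intros t; symmetry; apply Cpow_1_r.
  - rewrite S_INR, RtoC_plus.
    replace ((INR (S n) + 1) * z ^ S n)%C with (1 * z ^ S n + z * (INR (S n) * z ^ n))%C
      by (rewrite Cpow_S; ring).
    exact (is_derive_Cmult (fun w => w) (fun w => (w ^ S n)%C) z _ _ Hid IH).
Qed.

Lemma is_derive_Cinv (z : C) :
  z <> 0 -> @is_derive C_AbsRing C_NormedModule Cinv z (- / (z * z))%C.
Proof.
  intros Hz. apply is_derive_C_iff. intros eps Heps.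
  assert (Hp : 0 < Cmod z) by now apply Cmod_gt_0.
  set (a := Cmod z) in *.
  assert (Ha3 : 0 < a ^ 3) by now apply pow_lt.
  (* The remainder is exactly [(w - z)^2 / (w z^2)]. The first bound keeps [|w|] above [a / 2],
     hence the quotient below [2 |w - z|^2 / a^3], and the second makes this at most
     [eps |w - z|]. *)
  exists (Rmin (a / 2) (eps * a ^ 3 / 2)); split.
  { apply Rmin_pos; nra. }
  intros w Hw.
  pose proof (Rmin_l (a / 2) (eps * a ^ 3 / 2)); pose proof (Rmin_r (a / 2) (eps * a ^ 3 / 2)).
  assert (Hwa : a / 2 <= Cmod w).
  { assert (Cmod z <= Cmod w + Cmod (w - z)).
    { replace z with (w + - (w - z))%C at 1 by ring. eapply Rle_trans; [apply Cmod_triangle|].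
      rewrite Cmod_opp. lra. }
    unfold a in *; lra. }
  assert (Hw0 : w <> 0) by (apply Cmod_gt_0; lra).
  replace (/ w - / z - (w - z) * - / (z * z))%C with ((w - z) * (w - z) * / (w * (z * z)))%C
    by (field; auto).
  rewrite !Cmod_mult, Cmod_inv, !Cmod_mult by (repeat apply Cmult_neq_0; assumption).
  fold a. set (D := Cmod (w - z)) in *.
  assert (HD : 0 <= D) by apply Cmod_ge_0.
  assert (Hi : / (Cmod w * (a * a)) <= 2 / a ^ 3).
  { replace (2 / a ^ 3) with (/ (a / 2 * (a * a))) by (field; lra).
    apply Rinv_le_contravar; [nra|]. apply Rmult_le_compat_r; nra. }
  apply Rle_trans with (D * D * (2 / a ^ 3)); [apply Rmult_le_compat_l; nra|].
  replace (D * D * (2 / a ^ 3)) with (D * (2 / a ^ 3) * D) by ring.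
  apply Rmult_le_compat_r; [exact HD|].
  apply Rle_trans with (eps * a ^ 3 / 2 * (2 / a ^ 3)).
  - apply Rmult_le_compat_r; [|lra]. apply Rlt_le, Rdiv_lt_0_compat; lra.
  - right; field; lra.
Qed.

(** The series of the theorem start at index 1 and leave [a 0] arbitrary; putting 0 there gives an
    ordinary power series with the same sum. *)
Lemma Cpseries_zero_extend (a : nat -> C) (z s : C) :
  @is_series C_AbsRing C_NormedModule (fun k => (a (S k) * z ^ S k)%C) s ->
  is_Cpseries (fun m => if Nat.eq_dec m 0 then 0 else a m) z s.
Proof.
  intros H. apply is_series_decr_1.
  match goal with |- is_series _ ?l => replace l with s end; [exact H|].
  change (s = s + - (0 * z ^ 0))%C. ring.
Qed.

(** Termwise, [m c_m z^(m-1-n)] has the primitive [m c_m z^(m-n) / (m-n)], except for [m = n]: the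
    residue term [n c_n / z] is subtracted, and it is what later isolates the coefficient. Writing
    the primitive as [S / z^n] keeps to ordinary power series; its derivative is
    [(z S' - n S) / z^(n+1)], and [z S' - n S] is [z P'] without its term of index [n]. *)
Lemma laurent_antiderivative (c : nat -> C) (P : C -> C) (n : nat) :
  (forall z, unit_disc z -> is_Cpseries c z (P z)) ->
  exists A : C -> C, forall z, unit_disc z -> z <> 0 ->
    @is_derive C_AbsRing C_NormedModule A z (C_derive P z / z ^ n - INR n * c n / z)%C.
Proof.
  intros HP.
  set (s := fun m => if Nat.eq_dec m n then RtoC 0 else (INR m * c m / (INR m - INR n))%C).
  assert (Hne : forall m, m <> n -> (INR m - INR n)%C <> 0).
  { intros m Hm E. apply Hm, INR_eq. apply RtoC_inj.
    replace (RtoC (INR m)) with (INR m - INR n + INR n)%C by ring. rewrite E; ring. }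
  destruct (Cpseries_function s) as [S HS].
  (* The multipliers satisfy [|m / (m - n)| <= n + 1]: distinct naturals differ by at least 1, so
     [m <= n + |m - n| <= (n + 1) |m - n|]. *)
  { apply (converges_on_disc_le c s (INR n + 1)).
    - intros z Hz; exists (P z); now apply HP.
    - intros m. unfold s. pose proof (pos_INR n). pose proof (pos_INR m).
      destruct (Nat.eq_dec m n) as [->|Hm].
      + rewrite Cmod_0. apply Rmult_le_pos; [lra|apply Cmod_ge_0].
      + rewrite Cmod_div, Cmod_mult by now apply Hne.
        rewrite <- RtoC_minus, !Cmod_R, (Rabs_pos_eq (INR m)) by assumption.
        assert (H1 : 1 <= Rabs (INR m - INR n)).
        { destruct (Nat.lt_total m n) as [Hlt|[Heq|Hlt]]; [|contradiction|];
          apply le_INR in Hlt; rewrite S_INR in Hlt.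
          - rewrite Rabs_left; lra.
          - rewrite Rabs_pos_eq; lra. }
        assert (H2 : INR m <= (INR n + 1) * Rabs (INR m - INR n)).
        { assert (INR m <= INR n + Rabs (INR m - INR n)) by (pose proof (Rle_abs (INR m - INR n)); lra).
          nra. }
        apply Rmult_le_reg_r with (Rabs (INR m - INR n)); [lra|].
        unfold Rdiv. rewrite Rmult_assoc, Rinv_l by lra.
        pose proof (Cmod_ge_0 (c m)). nra. }
  exists (fun z => S z * / z ^ n)%C. intros z Hz Hz0.
  destruct (Cpseries_derive s S HS z Hz) as [HSd _].
  assert (E : (z * C_derive S z - INR n * S z = z * C_derive P z - INR n * c n * z ^ n)%C).
  { apply (is_Cseries_unique (fun m => (INR m * s m * z ^ m - INR n * (s m * z ^ m))%C)).
    - exact (is_series_minus _ _ _ _ (Cpseries_derive_mul s S z HS Hz)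
        (is_series_scal (RtoC (INR n)) _ _ (HS z Hz))).
    - eapply is_series_ext; [|exact (is_series_minus _ _ _ _ (Cpseries_derive_mul c P z HP Hz)
        (is_Cpseries_monomial n (INR n * c n)%C z))].
      intros m.
      change ((INR m * c m) * z ^ m - (if Nat.eq_dec m n then (INR n * c n)%C else 0) * z ^ m
         = INR m * s m * z ^ m - INR n * (s m * z ^ m))%C.
      unfold s. destruct (Nat.eq_dec m n) as [->|Hm]; [ring|].
      field. now apply Hne. }
  assert (Hinv : exists l, @is_derive C_AbsRing C_NormedModule (fun w => / w ^ n)%C z l /\ (l = - (INR n / (z ^ n * z)))%C).
  { destruct n as [|n].
    - exists (RtoC 0). split; [|cbn; unfold Cdiv; ring].
      apply (is_derive_ext (K := C_AbsRing) (V := C_NormedModule) (fun w => / 1)%C);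
        [reflexivity|exact (@is_derive_const C_AbsRing C_NormedModule (/ 1)%C z)].
    - eexists; split.
      + exact (@is_derive_comp C_AbsRing C_NormedModule Cinv (fun w => w ^ Datatypes.S n)%C z _ _
          (is_derive_Cinv _ (Cpow_nz z _ Hz0)) (proj2 (is_derive_C_AbsRing_iff _ _ _) (is_derive_Cpow n z))).
      + change (INR (Datatypes.S n) * z ^ n * (- / (z ^ Datatypes.S n * z ^ Datatypes.S n))
          = - (INR (Datatypes.S n) / (z ^ Datatypes.S n * z)))%C.
        rewrite Cpow_S. field. split; [exact Hz0|now apply Cpow_nz]. }
  destruct Hinv as [l [Hl El]].
  assert (Hzn := Cpow_nz z n Hz0).
  replace (C_derive P z / z ^ n - INR n * c n / z)%C with (C_derive S z * / z ^ n + S z * l)%C.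
  - exact (is_derive_Cmult S (fun w => / w ^ n)%C z _ _ HSd Hl).
  - rewrite El.
    transitivity ((z * C_derive S z - INR n * S z) / (z ^ n * z))%C; [field; auto|].
    rewrite E. field; auto.
Qed.

(** Only the powers [z^(m-1+n)] occur, and [m + n] never vanishes for [n >= 1], so no residue is
    left. The primitive is [z^n T], where [z T' + n T = z P'] coefficient by coefficient. *)
Lemma shifted_antiderivative (c : nat -> C) (P : C -> C) (n : nat) :
  (1 <= n)%nat -> (forall z, unit_disc z -> is_Cpseries c z (P z)) ->
  exists B : C -> C, forall z, unit_disc z ->
    @is_derive C_AbsRing C_NormedModule B z (z ^ n * C_derive P z)%C.
Proof.
  intros Hn HP. destruct n as [|n]; [lia|].
  set (t := fun m => (INR m * c m / (INR m + INR (S n)))%C).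
  assert (Hpos : forall m, 0 < INR m + INR (S n)).
  { intros m. pose proof (pos_INR m). pose proof (lt_0_INR (S n) ltac:(lia)). lra. }
  assert (Hne : forall m, (INR m + INR (S n))%C <> 0).
  { intros m. rewrite <- RtoC_plus. intros E. apply RtoC_inj in E. specialize (Hpos m). lra. }
  destruct (Cpseries_function t) as [T HT].
  { apply (converges_on_disc_le c t 1).
    - intros z Hz; exists (P z); now apply HP.
    - intros m. unfold t. rewrite Cmod_div, Cmod_mult by apply Hne.
      rewrite <- RtoC_plus, !Cmod_R, !Rabs_pos_eq by (try apply pos_INR; apply Rlt_le, Hpos).
      specialize (Hpos m). pose proof (pos_INR m). pose proof (pos_INR (S n)). pose proof (Cmod_ge_0 (c m)).
      apply Rmult_le_reg_r with (INR m + INR (S n)); [lra|].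
      unfold Rdiv. rewrite Rmult_assoc, Rinv_l by lra. nra. }
  exists (fun z => z ^ S n * T z)%C. intros z Hz.
  destruct (Cpseries_derive t T HT z Hz) as [HTd _].
  assert (E : (z * C_derive T z + INR (S n) * T z = z * C_derive P z)%C).
  { apply (is_Cseries_unique (fun m => (INR m * t m * z ^ m + INR (S n) * (t m * z ^ m))%C)).
    - exact (is_series_plus _ _ _ _ (Cpseries_derive_mul t T z HT Hz)
        (is_series_scal (RtoC (INR (S n))) _ _ (HT z Hz))).
    - eapply is_series_ext; [|exact (Cpseries_derive_mul c P z HP Hz)].
      intros m. change ((INR m * c m) * z ^ m = INR m * t m * z ^ m + INR (S n) * (t m * z ^ m))%C.
      unfold t. field. apply Hne. }
  replace (z ^ S n * C_derive P z)%C with (INR (S n) * z ^ n * T z + z ^ S n * C_derive T z)%C.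
  - exact (is_derive_Cmult (fun w => w ^ S n)%C T z _ _ (is_derive_Cpow n z) HTd).
  - rewrite Cpow_S. transitivity (z ^ n * (z * C_derive T z + INR (S n) * T z))%C; [ring|].
    rewrite E; ring.
Qed.

(** * The coefficient estimate *)

Lemma Re_Cdiv (v z : C) :
  z <> 0 -> Re (v / z) = (Re v * Re z + Im v * Im z) / (Re z ^ 2 + Im z ^ 2).
Proof.
  intros Hz. apply Cmod_gt_0 in Hz. pose proof (Cmod2_alt z) as E.
  assert (0 < Cmod z ^ 2) by now apply pow_lt.
  rewrite E in H. unfold Re, Im in *; cbn in *. field. lra.
Qed.

Lemma Im_Cdiv (v z : C) :
  z <> 0 -> Im (v / z) = (Im v * Re z - Re v * Im z) / (Re z ^ 2 + Im z ^ 2).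
Proof.
  intros Hz. apply Cmod_gt_0 in Hz. pose proof (Cmod2_alt z) as E.
  assert (0 < Cmod z ^ 2) by now apply pow_lt.
  rewrite E in H. unfold Re, Im in *; cbn in *. field. lra.
Qed.

Lemma is_derive_half_ln_sum_sq (x y : R -> R) (t x' y' : R) :
  0 < x t ^ 2 + y t ^ 2 -> is_derive x t x' -> is_derive y t y' ->
  is_derive (fun s => / 2 * ln (x s ^ 2 + y s ^ 2)) t
    ((x' * x t + y' * y t) / (x t ^ 2 + y t ^ 2)).
Proof.
  intros Hp H1 H2. auto_derive.
  - split; [exists x'; exact H1|]. split; [exists y'; exact H2|]. split; [cbn in Hp; lra|exact I].
  - replace (Derive _ t) with x' by (symmetry; now apply is_derive_unique).
    replace (Derive _ t) with y' by (symmetry; now apply is_derive_unique).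
    cbn in Hp. field. cbn in *; lra.
Qed.

Lemma is_derive_ln_curve (c : R -> C) (t : R) (v : C) :
  c t <> 0 -> @is_derive R_AbsRing C_R_NormedModule c t v ->
  is_derive (fun s => / 2 * ln (Re (c s) ^ 2 + Im (c s) ^ 2)) t (Re (v / c t)).
Proof.
  intros Hc Hd. rewrite Re_Cdiv by assumption.
  apply is_derive_curve_components in Hd. destruct Hd as [H1 H2].
  apply (is_derive_half_ln_sum_sq (fun s => Re (c s)) (fun s => Im (c s))); try assumption.
  apply Cmod_gt_0 in Hc. rewrite <- Cmod2_alt. now apply pow_lt.
Qed.

(** The difference equals [-(1 - |z|^(2n)) / z^n]: the two functions agree on the unit circle, which
    is why the correction term dies out as the curve approaches the boundary. *)
Lemma Cmod_inv_sub_conj_le (z : C) (r : R) (n : nat) :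
  0 < r -> r <= Cmod z < 1 -> Cmod (Cconj (z ^ n) - / z ^ n) <= (1 - r ^ (2 * n)) / r ^ n.
Proof.
  intros Hr Hz.
  assert (Hz0 : z <> 0) by (apply Cmod_gt_0; lra).
  assert (Hn := Cpow_nz z n Hz0).
  assert (Hp : 0 < Cmod z ^ n) by (apply pow_lt; lra).
  assert (Hrn : 0 < r ^ n) by now apply pow_lt.
  assert (Hle : r ^ n <= Cmod z ^ n) by (apply pow_incr; lra).
  assert (Hle1 : Cmod z ^ n <= 1) by (rewrite <- (pow1 n); apply pow_incr; lra).
  replace (Cconj (z ^ n) - / z ^ n)%C with (- ((1 - RtoC ((Cmod z ^ n) ^ 2)) / z ^ n))%C.
  2: { rewrite <- Cmod_pow, Cmod2_conj. field. exact Hn. }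
  rewrite Cmod_opp, Cmod_div, <- RtoC_minus, Cmod_R, Cmod_pow by exact Hn.
  rewrite Nat.mul_comm, pow_mult.
  set (x := Cmod z ^ n) in *. set (y := r ^ n) in *.
  rewrite Rabs_pos_eq by nra.
  unfold Rdiv. apply Rmult_le_compat; [nra| |nra|].
  - apply Rlt_le, Rinv_0_lt_compat; lra.
  - apply Rinv_le_contravar; lra.
Qed.

(** [Psi] is a primitive of [h' v / z^n + conj (z^n g' v)] along the curve, with a logarithm [L] of
    [gam] supplying the residue term. On the closed curve [A], [B] and [ln |gam|] return to their
    initial values, so the increment of [Psi] is [n c_n] times [i] times that of [theta]. No
    relation between the sizes of [h'] and [g'] is assumed, so the lemma also applies with [h] and
    [g] exchanged. *)
Lemma coefficient_estimate (h g : C -> C) (c d : nat -> C) (gam v : R -> C) (theta : R -> R)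
    (n : nat) (K r : R) :
  (1 <= n)%nat ->
  (forall z, unit_disc z -> is_Cpseries c z (h z)) ->
  (forall z, unit_disc z -> is_Cpseries d z (g z)) ->
  0 < r ->
  (forall t, 0 <= t <= 2 * PI ->
     r <= Cmod (gam t) < 1 /\
     @is_derive R_AbsRing C_R_NormedModule gam t (v t) /\
     is_derive theta t (Im (v t / gam t)) /\
     Cmod (C_derive h (gam t) * v t + Cconj (C_derive g (gam t) * v t)) <= 1 /\
     Cmod (C_derive g (gam t) * v t) <= K) ->
  gam (2 * PI) = gam 0 ->
  2 * PI <= theta (2 * PI) - theta 0 ->
  INR n * Cmod (c n) <= (1 + K * (1 - r ^ (2 * n))) / r ^ n.
Proof.
  intros Hn Hh Hg Hr Hgam Hclosed Hwind.
  destruct (laurent_antiderivative c h n Hh) as [A HA].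
  destruct (shifted_antiderivative d g n Hn Hg) as [B HB].
  set (L := fun t => (/ 2 * ln (Re (gam t) ^ 2 + Im (gam t) ^ 2), theta t) : C).
  set (q := (INR n * c n)%C).
  set (Psi := fun t => (A (gam t) + q * L t + Cconj (B (gam t)))%C).
  pose proof PI_RGT_0 as HPI.
  assert (HM : Cmod (Psi (2 * PI) - Psi 0) <= (1 + K * (1 - r ^ (2 * n))) / r ^ n * (2 * PI - 0)).
  { apply (curve_mean_value Psi (fun t =>
      (C_derive h (gam t) / gam t ^ n - INR n * c n / gam t) * v t
      + q * (v t / gam t) + Cconj (gam t ^ n * C_derive g (gam t) * v t))%C); [lra| |].
    - intros t Ht. destruct (Hgam t Ht) as [Hm [Hd [Hth _]]].
      assert (Hz0 : gam t <> 0) by (apply Cmod_gt_0; lra).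
      assert (HL : @is_derive R_AbsRing C_R_NormedModule L t (v t / gam t)%C).
      { apply is_derive_curve_components. split; [|exact Hth].
        exact (is_derive_ln_curve gam t (v t) Hz0 Hd). }
      apply (@is_derive_plus R_AbsRing C_R_NormedModule (fun t => (A (gam t) + q * L t)%C) (fun t => Cconj (B (gam t)))).
      + apply (@is_derive_plus R_AbsRing C_R_NormedModule (fun t => A (gam t)) (fun t => (q * L t)%C)).
        * exact (is_derive_curve_comp A gam t _ _ (HA _ (proj2 Hm) Hz0) Hd).
        * apply (is_derive_curve_comp (fun w => (q * w)%C) L t q); [|exact HL].
          apply is_derive_C_iff. intros eps Heps. exists 1; split; [lra|]. intros w _.
          replace (q * w - q * L t - (w - L t) * q)%C with (RtoC 0) by ring.
          rewrite Cmod_0. apply Rmult_le_pos; [lra|apply Cmod_ge_0].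
      + apply is_derive_curve_conj.
        exact (is_derive_curve_comp B gam t _ _ (HB _ (proj2 Hm)) Hd).
    - intros t Ht. destruct (Hgam t Ht) as [Hm [_ [_ [H1 HK]]]].
      assert (Hz0 : gam t <> 0) by (apply Cmod_gt_0; lra).
      assert (Hzn := Cpow_nz (gam t) n Hz0).
      assert (Hrn : 0 < r ^ n) by now apply pow_lt.
      set (p' := C_derive h (gam t)) in *. set (q' := C_derive g (gam t)) in *.
      (* The two residue terms cancel. What remains is regrouped around [omega(v)], bounded by 1,
         and a multiple of [conj (g' v)] that is small near the unit circle. *)
      replace ((p' / gam t ^ n - INR n * c n / gam t) * v t + q * (v t / gam t)
          + Cconj (gam t ^ n * q' * v t))%C
        with (/ gam t ^ n * (p' * v t + Cconj (q' * v t))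
          + (Cconj (gam t ^ n) - / gam t ^ n) * Cconj (q' * v t))%C.
      2: { unfold q. rewrite !Cmult_conj. field. auto. }
      eapply Rle_trans; [apply Cmod_triangle|]. rewrite !Cmod_mult, Cmod_conj, Cmod_inv, Cmod_pow by assumption.
      replace ((1 + K * (1 - r ^ (2 * n))) / r ^ n) with (/ r ^ n * 1 + (1 - r ^ (2 * n)) / r ^ n * K) by (field; lra).
      apply Rplus_le_compat; apply Rmult_le_compat; try apply Cmod_ge_0; try assumption.
      + apply Rlt_le, Rinv_0_lt_compat, pow_lt; lra.
      + apply Rinv_le_contravar; [assumption|]. apply pow_incr; lra.
      + apply Cmod_inv_sub_conj_le; assumption. }
  assert (E : (Psi (2 * PI)%R - Psi 0)%C = (q * (Ci * RtoC (theta (2 * PI)%R - theta 0)))%C).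
  { unfold Psi, L. rewrite Hclosed. rewrite RtoC_minus.
    set (l := / 2 * ln (Re (gam 0) ^ 2 + Im (gam 0) ^ 2)).
    assert (Ep : forall x y : R, ((x, y) : C) = (RtoC x + Ci * RtoC y)%C)
      by (intros; apply injective_projections; cbn; ring).
    rewrite !Ep. ring. }
  rewrite E in HM. unfold q in HM. rewrite !Cmod_mult, Cmod_Ci, !Cmod_R, (Rabs_pos_eq (INR n)), (Rabs_pos_eq (theta _ - _)) in HM
    by (try apply pos_INR; lra).
  assert (Hnc : 0 <= INR n * Cmod (c n)) by (apply Rmult_le_pos; [apply pos_INR|apply Cmod_ge_0]).
  apply Rmult_le_reg_r with (2 * PI); [lra|]. nra.
Qed.

(** * Inverting curves and winding numbers *)

Lemma Cconj_R (x : R) : Cconj (RtoC x) = RtoC x.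
Proof. apply injective_projections; cbn; ring. Qed.

Lemma Cmod_wirtinger_ge (p q x : C) :
  (Cmod p - Cmod q) * Cmod x <= Cmod (p * x + Cconj (q * x)).
Proof.
  assert (H : Cmod (p * x) <= Cmod (p * x + Cconj (q * x)) + Cmod (q * x)).
  { replace (p * x)%C with ((p * x + Cconj (q * x)) + - Cconj (q * x))%C at 1 by ring.
    eapply Rle_trans; [apply Cmod_triangle|]. rewrite Cmod_opp, Cmod_conj. lra. }
  rewrite !Cmod_mult in H. lra.
Qed.

(** This is Cramer's rule for the equation together with its conjugate, in the unknowns [v] and
    [conj v]; the determinant is the Jacobian [|p|^2 - |q|^2]. *)
Lemma wirtinger_solve (p q w : C) :
  Cmod q < Cmod p ->
  let v := ((Cconj p * w - Cconj q * Cconj w) / RtoC (Cmod p ^ 2 - Cmod q ^ 2))%C in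
  (p * v + Cconj (q * v))%C = w.
Proof.
  intros H v.
  assert (HJ : 0 < Cmod p ^ 2 - Cmod q ^ 2) by (pose proof (Cmod_ge_0 q); nra).
  assert (HJ' : RtoC (Cmod p ^ 2 - Cmod q ^ 2) <> 0) by (intros E; apply RtoC_inj in E; lra).
  assert (E : RtoC (Cmod p ^ 2 - Cmod q ^ 2) = (p * Cconj p - q * Cconj q)%C)
    by (rewrite RtoC_minus, !Cmod2_conj; reflexivity).
  unfold v. rewrite Cmult_conj, Cdiv_conj, Cconj_R, Cminus_conj, !Cmult_conj, !Cconj_conj by exact HJ'.
  rewrite E in *. field. exact HJ'.
Qed.

(** Here [gam] is merely continuous at [t]. The bound [(|p| - |q|) |x| <= |p x + conj (q x)|] is
    used twice: on the increment [D] of [gam], to get [|D| <= M |s - t|], and then on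
    [D - (s - t) v], whose image is now [o(s - t)]. *)
Lemma is_derive_curve_inverse (h g : C -> C) (gam c : R -> C) (t : R) (p q v w : C) :
  @is_derive C_AbsRing C_NormedModule h (gam t) p ->
  @is_derive C_AbsRing C_NormedModule g (gam t) q ->
  Cmod q < Cmod p ->
  (forall s, c s = h (gam s) + Cconj (g (gam s)))%C ->
  @is_derive R_AbsRing C_R_NormedModule c t w ->
  (forall eps, 0 < eps -> exists d, 0 < d /\
     forall s, Rabs (s - t) < d -> Cmod (gam s - gam t) < eps) ->
  (p * v + Cconj (q * v))%C = w ->
  @is_derive R_AbsRing C_R_NormedModule gam t v.
Proof.
  intros Hh Hg Hpq Hc Hd Hcont Hv.
  rewrite is_derive_C_iff in Hh, Hg. rewrite is_derive_curve_iff in Hd |- *.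
  set (m := Cmod p - Cmod q). assert (Hm : 0 < m) by (unfold m; lra).
  set (M := 2 / m * (Cmod w + 1)).
  assert (HM : 0 < M).
  { pose proof (Cmod_ge_0 w). apply Rmult_lt_0_compat; [apply Rdiv_lt_0_compat|]; lra. }
  intros eps Heps.
  (* The bound [m / 2] lets [e |D|] be absorbed into [m |D|], the bound 1 limits the error in [c]
     during that first pass, and the last bound makes the final error [e (M + 1) |s - t|] at most
     [m eps |s - t|]. *)
  set (e := Rmin (Rmin 1 (m / 2)) (eps * m / (M + 1))).
  assert (He : 0 < e).
  { repeat apply Rmin_pos; try lra. apply Rdiv_lt_0_compat; [nra|lra]. }
  assert (He1 : e <= 1) by (eapply Rle_trans; [apply Rmin_l|apply Rmin_l]).
  assert (He2 : e <= m / 2) by (eapply Rle_trans; [apply Rmin_l|apply Rmin_r]).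
  assert (He3 : e <= eps * m / (M + 1)) by apply Rmin_r.
  destruct (Hh (e / 2)) as [dh [Hdh Hh']]; [lra|].
  destruct (Hg (e / 2)) as [dg [Hdg Hg']]; [lra|].
  destruct (Hcont (Rmin dh dg)) as [d1 [Hd1 Hc1]]; [now apply Rmin_pos|].
  destruct (Hd e He) as [d2 [Hd2 Hc2]].
  exists (Rmin d1 d2); split; [now apply Rmin_pos|]. intros s Hs.
  pose proof (Rmin_l d1 d2); pose proof (Rmin_r d1 d2).
  specialize (Hc1 s ltac:(lra)). specialize (Hc2 s ltac:(lra)).
  pose proof (Rmin_l dh dg); pose proof (Rmin_r dh dg).
  specialize (Hh' (gam s) ltac:(lra)). specialize (Hg' (gam s) ltac:(lra)).
  set (D := (gam s - gam t)%C) in *.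
  assert (HT : Cmod (p * D + Cconj (q * D) - (c s - c t)) <= e * Cmod D).
  { rewrite !Hc.
    replace (p * D + Cconj (q * D) - (h (gam s) + Cconj (g (gam s)) - (h (gam t) + Cconj (g (gam t)))))%C
      with (- (h (gam s) - h (gam t) - D * p) + - Cconj (g (gam s) - g (gam t) - D * q))%C
      by (rewrite !Cminus_conj, !Cmult_conj; ring).
    eapply Rle_trans; [apply Cmod_triangle|]. rewrite !Cmod_opp, Cmod_conj. lra. }
  assert (HD : Cmod D <= M * Rabs (s - t)).
  { pose proof (Cmod_wirtinger_ge p q D) as H3. fold m in H3.
    assert (H4 : Cmod (p * D + Cconj (q * D)) <= e * Cmod D + (e * Rabs (s - t) + Rabs (s - t) * Cmod w)).
    { replace (p * D + Cconj (q * D))%C with ((p * D + Cconj (q * D) - (c s - c t))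
        + ((c s - c t - RtoC (s - t) * w) + RtoC (s - t) * w))%C by ring.
      eapply Rle_trans; [apply Cmod_triangle|]. apply Rplus_le_compat; [exact HT|].
      eapply Rle_trans; [apply Cmod_triangle|]. rewrite Cmod_mult, Cmod_R. lra. }
    pose proof (Cmod_ge_0 D). pose proof (Rabs_pos (s - t)).
    assert (HmD : m / 2 * Cmod D <= (Cmod w + 1) * Rabs (s - t)) by nra.
    apply Rmult_le_reg_l with (m / 2); [lra|]. unfold M.
    replace (m / 2 * (2 / m * (Cmod w + 1) * Rabs (s - t))) with ((Cmod w + 1) * Rabs (s - t)) by (field; lra).
    exact HmD. }
  pose proof (Cmod_wirtinger_ge p q (D - RtoC (s - t) * v)) as H3. fold m in H3.
  assert (H4 : Cmod (p * (D - RtoC (s - t) * v) + Cconj (q * (D - RtoC (s - t) * v)))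
     <= e * (M + 1) * Rabs (s - t)).
  { replace (p * (D - RtoC (s - t) * v) + Cconj (q * (D - RtoC (s - t) * v)))%C
      with ((p * D + Cconj (q * D) - (c s - c t)) + (c s - c t - RtoC (s - t) * w))%C.
    2: { rewrite <- Hv, !Cmult_conj, Cminus_conj, !Cmult_conj, Cconj_R. ring. }
    eapply Rle_trans; [apply Cmod_triangle|].
    assert (e * Cmod D <= e * (M * Rabs (s - t))) by (apply Rmult_le_compat_l; lra). lra. }
  apply Rmult_le_reg_l with m; [exact Hm|].
  apply Rle_trans with (1 := H3). apply Rle_trans with (1 := H4).
  replace (m * (eps * Rabs (s - t))) with (eps * m / (M + 1) * (M + 1) * Rabs (s - t)) by (field; lra).
  apply Rmult_le_compat_r; [apply Rabs_pos|]. apply Rmult_le_compat_r; lra.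
Qed.

(** Since [1 - cos x = 2 sin^2 (x / 2)], cosine 1 is excluded on the open interval from 0 to [2 pi].
    This gap stands in for the integrality of winding numbers. *)
Lemma lt_2PI_of_cos_eq_1 (x : R) : cos x = 1 -> x < 2 * PI -> x <= 0.
Proof.
  intros Hc Hx. apply Rnot_lt_le. intros H0.
  assert (Hs : 0 < sin (x / 2)) by (apply sin_gt_0; lra).
  replace x with (2 * (x / 2)) in Hc by field. rewrite cos_2a_sin in Hc. nra.
Qed.

(* The two functions are the real and imaginary parts of [(x + i y) exp (- l - i theta)],
   and the hypotheses say that [l + i theta] is a logarithm of [x + i y] up to a constant. *)
Lemma polar_lift_invariant (x y l theta : R -> R) (t x' y' : R) :
  0 < x t ^ 2 + y t ^ 2 ->
  is_derive x t x' -> is_derive y t y' ->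
  is_derive l t ((x' * x t + y' * y t) / (x t ^ 2 + y t ^ 2)) ->
  is_derive theta t ((y' * x t - x' * y t) / (x t ^ 2 + y t ^ 2)) ->
  is_derive (fun s => exp (- l s) * (x s * cos (theta s) + y s * sin (theta s))) t 0 /\
  is_derive (fun s => exp (- l s) * (y s * cos (theta s) - x s * sin (theta s))) t 0.
Proof.
  intros Hp Hx Hy Hl Ht.
  assert (E : forall (u : R -> R) u', is_derive u t u' -> Derive (fun s => u s) t = u')
    by (intros u u' Hu; now apply is_derive_unique).
  split; auto_derive;
    try (repeat split; eexists; eassumption);
    rewrite (E x x' Hx), (E y y' Hy), (E l _ Hl), (E theta _ Ht); cbn in Hp; field; cbn; lra.
Qed.

(** With [l = ln |gam|], the product [gam exp (- l - i theta)] is constant. At the two ends [gam]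
    and [l] agree, hence [exp (- i theta(T)) = 1]. *)
Lemma closed_curve_cos_lift (gam v : R -> C) (theta : R -> R) (T : R) :
  0 < T ->
  (forall t, 0 <= t <= T ->
     gam t <> 0 /\ @is_derive R_AbsRing C_R_NormedModule gam t (v t) /\
     is_derive theta t (Im (v t / gam t))) ->
  gam T = gam 0 -> theta 0 = 0 -> cos (theta T) = 1.
Proof.
  intros HT H Hclosed H0.
  set (x := fun s => Re (gam s)). set (y := fun s => Im (gam s)).
  set (l := fun s => / 2 * ln (x s ^ 2 + y s ^ 2)).
  assert (Hinv : forall t, 0 <= t <= T -> 0 < x t ^ 2 + y t ^ 2 /\
    is_derive (fun s => exp (- l s) * (x s * cos (theta s) + y s * sin (theta s))) t 0 /\
    is_derive (fun s => exp (- l s) * (y s * cos (theta s) - x s * sin (theta s))) t 0).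
  { intros t Ht. destruct (H t Ht) as [Hne [Hd Hth]].
    rewrite Im_Cdiv in Hth by exact Hne.
    pose proof (is_derive_ln_curve gam t (v t) Hne Hd) as Hl. rewrite Re_Cdiv in Hl by exact Hne.
    apply is_derive_curve_components in Hd. destruct Hd as [Hx Hy].
    assert (Hp : 0 < x t ^ 2 + y t ^ 2).
    { unfold x, y. rewrite <- Cmod2_alt. apply pow_lt. now apply Cmod_gt_0. }
    split; [exact Hp|].
    exact (polar_lift_invariant x y l theta t _ _ Hp Hx Hy Hl Hth). }
  assert (Hconst : forall F : R -> R, (forall t, 0 <= t <= T -> is_derive F t 0) -> F T = F 0).
  { intros F HF. destruct (MVT_cor2 F (fun _ => 0) 0 T HT) as [xi [E _]].
    - intros c Hc. now apply is_derive_Reals, HF.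
    - lra. }
  assert (E1 := Hconst _ (fun t Ht => proj1 (proj2 (Hinv t Ht)))). cbn beta in E1.
  assert (E2 := Hconst _ (fun t Ht => proj2 (proj2 (Hinv t Ht)))). cbn beta in E2.
  destruct (Hinv 0 ltac:(lra)) as [Hp _].
  assert (Ex : x T = x 0) by (unfold x; now rewrite Hclosed).
  assert (Ey : y T = y 0) by (unfold y; now rewrite Hclosed).
  assert (El : l T = l 0) by (unfold l; now rewrite Ex, Ey).
  rewrite Ex, Ey, El, H0, cos_0, sin_0 in E1, E2.
  apply Rmult_eq_reg_l in E1; [|pose proof (exp_pos (- l 0)); lra].
  apply Rmult_eq_reg_l in E2; [|pose proof (exp_pos (- l 0)); lra].
  apply Rmult_eq_reg_l with (x 0 ^ 2 + y 0 ^ 2); [|lra].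
  set (C0 := cos (theta T)) in *. set (S0 := sin (theta T)) in *.
  replace ((x 0 ^ 2 + y 0 ^ 2) * C0) with (x 0 * (x 0 * C0 + y 0 * S0) + y 0 * (y 0 * C0 - x 0 * S0)) by ring.
  rewrite E1, E2. ring.
Qed.

Lemma continuity_2d_pt_snd (f : R -> R -> R) (x y : R) :
  continuity_2d_pt f x y -> continuous (f x) y.
Proof.
  intros H. apply continuity_pt_filterlim.
  intros eps Heps. destruct (H (mkposreal eps Heps)) as [d Hd].
  exists d; split; [apply cond_pos|]. intros u [_ Hu].
  apply Hd; [|exact Hu]. rewrite Rminus_eq_0, Rabs_R0. apply cond_pos.
Qed.

Lemma ex_RInt_continuity_2d (f : R -> R -> R) (x T : R) :
  0 < T -> (forall t, 0 <= t <= T -> continuity_2d_pt f x t) -> ex_RInt (f x) 0 T.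
Proof.
  intros HT H. apply (@ex_RInt_continuous R_CompleteNormedModule). intros z Hz.
  rewrite Rmin_left, Rmax_right in Hz by lra. now apply continuity_2d_pt_snd, H.
Qed.

Lemma continuity_pt_RInt_param (f : R -> R -> R) (T x d0 : R) :
  0 < T -> 0 < d0 ->
  (forall u t, Rabs (u - x) < d0 -> 0 <= t <= T -> continuity_2d_pt f u t) ->
  continuity_pt (fun u => RInt (f u) 0 T) x.
Proof.
  intros HT Hd0 Hf eps Heps.
  assert (Hx : forall t, 0 <= t <= T -> continuity_2d_pt f x t).
  { intros t Ht. apply Hf; [|exact Ht]. now rewrite Rminus_eq_0, Rabs_R0. }
  assert (He : 0 < eps / (2 * T)) by (apply Rdiv_lt_0_compat; lra).
  destruct (uniform_continuity_2d_1d' f 0 T x Hx (mkposreal _ He)) as [d Hd].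
  exists (Rmin d d0); split; [apply Rmin_pos; [apply cond_pos|exact Hd0]|].
  intros u [_ Hu]. change (Rabs (u - x) < Rmin d d0) in Hu.
  change (Rabs (RInt (f u) 0 T - RInt (f x) 0 T) < eps).
  pose proof (Rmin_l d d0); pose proof (Rmin_r d d0).
  assert (Iu : ex_RInt (f u) 0 T).
  { apply ex_RInt_continuity_2d; [exact HT|]. intros t Ht; apply Hf; [lra|exact Ht]. }
  assert (Ix : ex_RInt (f x) 0 T) by (now apply ex_RInt_continuity_2d).
  assert (E := RInt_minus (f u) (f x) 0 T Iu Ix).
  change (RInt (fun t => minus (f u t) (f x t)) 0 T = RInt (f u) 0 T - RInt (f x) 0 T) in E.
  rewrite <- E.
  apply Rle_lt_trans with (T * (eps / (2 * T))).
  - replace (T * (eps / (2 * T))) with ((T - 0) * (eps / (2 * T))) by ring.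
    apply (norm_RInt_le_const (V := R_NormedModule) (fun t => minus (f u t) (f x t)) 0 T); [lra| |].
    + intros t Ht. apply Rlt_le. apply (Hd t x t u); try lra.
      * pose proof (cond_pos d); lra.
      * assert (Hu' : Rabs (u - x) < d) by lra. apply Rabs_def2 in Hu'. lra.
      * rewrite Rminus_eq_0, Rabs_R0. apply cond_pos.
    + apply (@RInt_correct R_CompleteNormedModule). apply (@ex_RInt_minus R_NormedModule); assumption.
  - replace (T * (eps / (2 * T))) with (eps / 2) by (field; lra). lra.
Qed.

(* Homotopy invariance: the winding number of the curve with parameter [rho] cannot jump
   away from a positive value without passing through [1 / 2]. *)
Lemma winding_ge_2PI (G : R -> R -> R) :
  (forall rho t, 0 < rho < 1 -> continuity_2d_pt G rho t) ->
  (forall rho, 0 < rho < 1 -> cos (RInt (G rho) 0 (2 * PI)) = 1) ->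
  (exists d, 0 < d /\ forall rho t, 0 < rho < d -> rho < 1 -> 0 < G rho t) ->
  forall rho, 0 < rho < 1 -> 2 * PI <= RInt (G rho) 0 (2 * PI).
Proof.
  intros HG Hcos [d [Hd Hpos]] rho Hrho.
  set (Th := fun u => RInt (G u) 0 (2 * PI)).
  pose proof PI_RGT_0 as HPI.
  apply Rnot_lt_le; intros Hlt.
  pose proof (lt_2PI_of_cos_eq_1 _ (Hcos rho Hrho) Hlt) as Hle.
  set (r0 := Rmin (d / 2) (rho / 2)).
  assert (Hr0 : 0 < r0) by (apply Rmin_pos; lra).
  pose proof (Rmin_l (d / 2) (rho / 2)) as Hl. pose proof (Rmin_r (d / 2) (rho / 2)) as Hr.
  fold r0 in Hl, Hr.
  assert (H0 : 0 < Th r0).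
  { apply RInt_gt_0; [lra| |].
    - intros; apply Hpos; lra.
    - intros; apply continuity_2d_pt_snd, HG; lra. }
  (* A positive increment with cosine 1 cannot lie below [2 pi]. On the other side the same gap has
     put the increment at [rho] below 0, so the value [pi] is attained in between, where the cosine
     is -1. *)
  assert (H1 : 2 * PI <= Th r0).
  { apply Rnot_lt_le; intros Hlt0.
    pose proof (lt_2PI_of_cos_eq_1 _ (Hcos r0 ltac:(lra)) Hlt0). unfold Th in H0. lra. }
  destruct (IVT_interv (fun u => PI - Th u) r0 rho) as [z [Hz Ez]].
  - intros u Hu. apply continuity_pt_minus; [apply continuity_pt_const; intros ? ?; reflexivity|].
    apply (continuity_pt_RInt_param G (2 * PI) u (Rmin u (1 - u))); [lra|apply Rmin_pos; lra|].
    intros u' t Hu' _. apply HG.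
    pose proof (Rmin_l u (1 - u)); pose proof (Rmin_r u (1 - u)).
    apply Rabs_def2 in Hu'. lra.
  - lra.
  - lra.
  - unfold Th; lra.
  - assert (E : RInt (G z) 0 (2 * PI) = PI) by (unfold Th in Ez; lra).
    specialize (Hcos z ltac:(lra)). rewrite E, cos_PI in Hcos. lra.
Qed.

(** * Continuity on the disc *)

Lemma continuous_C_components (U : UniformSpace) (F : U -> C) (x : U) :
  @continuous U C_UniformSpace F x <->
  continuous (fun u => Re (F u)) x /\ continuous (fun u => Im (F u)) x.
Proof.
  split.
  - intros H; split; intros P HP.
    + apply (H (fun z => P (Re z))). destruct HP as [e He]. exists e. intros y Hy. apply He, Hy.
    + apply (H (fun z => P (Im z))). destruct HP as [e He]. exists e. intros y Hy. apply He, Hy.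
  - intros [H1 H2] P [e He].
    assert (L1 := H1 _ (locally_ball (Re (F x)) e)).
    assert (L2 := H2 _ (locally_ball (Im (F x)) e)).
    unfold filtermap in *. generalize (filter_and _ _ L1 L2).
    apply filter_imp. intros u [Hu1 Hu2]. apply He. split; assumption.
Qed.

Lemma continuous_Cminus (U : UniformSpace) (F G : U -> C) (x : U) :
  @continuous U C_UniformSpace F x -> @continuous U C_UniformSpace G x ->
  @continuous U C_UniformSpace (fun u => F u - G u)%C x.
Proof. exact (@continuous_minus U C_AbsRing C_NormedModule F G x). Qed.

Lemma continuous_Cconj (U : UniformSpace) (F : U -> C) (x : U) :
  @continuous U C_UniformSpace F x -> @continuous U C_UniformSpace (fun u => Cconj (F u)) x.
Proof.
  rewrite !continuous_C_components. intros [H1 H2]; split; [exact H1|].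
  exact (@continuous_opp U R_AbsRing R_NormedModule _ x H2).
Qed.

Lemma continuous_Cmult (U : UniformSpace) (F G : U -> C) (x : U) :
  @continuous U C_UniformSpace F x -> @continuous U C_UniformSpace G x ->
  @continuous U C_UniformSpace (fun u => F u * G u)%C x.
Proof.
  rewrite !continuous_C_components. intros [F1 F2] [G1 G2]; split.
  - apply (@continuous_minus U R_AbsRing R_NormedModule (fun u => Re (F u) * Re (G u)) (fun u => Im (F u) * Im (G u)));
      apply (@continuous_mult U R_AbsRing); assumption.
  - apply (@continuous_plus U R_AbsRing R_NormedModule (fun u => Re (F u) * Im (G u)) (fun u => Im (F u) * Re (G u)));
      apply (@continuous_mult U R_AbsRing); assumption.
Qed.

Lemma continuous_Cinv (U : UniformSpace) (F : U -> C) (x : U) :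
  F x <> 0 -> @continuous U C_UniformSpace F x -> @continuous U C_UniformSpace (fun u => / F u)%C x.
Proof.
  intros Hne. rewrite !continuous_C_components. intros [F1 F2].
  assert (Hn : Re (F x) ^ 2 + Im (F x) ^ 2 <> 0).
  { rewrite <- Cmod2_alt. apply pow_nonzero. apply Cmod_gt_0 in Hne. lra. }
  assert (HN : continuous (fun u => / (Re (F u) ^ 2 + Im (F u) ^ 2)) x).
  { apply (continuous_comp (fun u => Re (F u) ^ 2 + Im (F u) ^ 2) Rinv).
    - apply (@continuous_plus U R_AbsRing R_NormedModule (fun u => Re (F u) ^ 2) (fun u => Im (F u) ^ 2));
      repeat apply (@continuous_mult U R_AbsRing); try assumption; apply continuous_const.
    - now apply continuous_Rinv. }
  split.
  - apply (@continuous_mult U R_AbsRing (fun u => Re (F u)) (fun u => / (Re (F u) ^ 2 + Im (F u) ^ 2))); assumption.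
  - apply (@continuous_mult U R_AbsRing (fun u => - Im (F u)) (fun u => / (Re (F u) ^ 2 + Im (F u) ^ 2))); [|assumption].
    apply (@continuous_opp U R_AbsRing R_NormedModule); assumption.
Qed.

Lemma continuous_C_iff_eps (F : C -> C) (z : C) :
  @continuous C_UniformSpace C_UniformSpace F z <->
  forall eps, 0 < eps -> exists d, 0 < d /\
    forall w, Cmod (w - z) < d -> Cmod (F w - F z) < eps.
Proof.
  split.
  - intros H eps Heps.
    assert (L : @locally C_UniformSpace (F z) (fun y => Cmod (y - F z) < eps)).
    { apply locally_C. exists (mkposreal eps Heps). intros y Hy; exact Hy. }
    apply H in L. apply locally_C in L. destruct L as [d Hd].
    exists d; split; [apply cond_pos|]. intros w Hw; exact (Hd w Hw).
  - intros H P HP. apply locally_C in HP. destruct HP as [e He].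
    destruct (H e (cond_pos e)) as [d [Hd Hd']].
    apply locally_C. exists (mkposreal d Hd). intros w Hw. apply He. exact (Hd' w Hw).
Qed.

Lemma is_derive_C_continuous (F : C -> C) (z l : C) :
  @is_derive C_AbsRing C_NormedModule F z l -> @continuous C_UniformSpace C_UniformSpace F z.
Proof.
  intros H P HP. apply locally_C.
  exact (@ex_derive_continuous C_AbsRing C_NormedModule F z (ex_intro _ l H) P HP).
Qed.

(** [C_derive P] is itself the sum of a power series on the disc, so [Cpseries_derive] applies to it
    in turn and makes it differentiable. *)
Lemma continuous_C_derive_Cpseries (c : nat -> C) (P : C -> C) (z : C) :
  (forall z, unit_disc z -> is_Cpseries c z (P z)) -> unit_disc z ->
  @continuous C_UniformSpace C_UniformSpace (C_derive P) z.
Proof.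
  intros HP Hz.
  destruct (Cpseries_derive _ _ (fun w Hw => proj2 (Cpseries_derive c P HP w Hw)) z Hz) as [Hd _].
  exact (is_derive_C_continuous _ _ _ Hd).
Qed.

Lemma locally_unit_disc (z : C) : unit_disc z -> @locally C_UniformSpace z unit_disc.
Proof.
  intros Hz. unfold unit_disc in *. apply locally_C.
  assert (Hp : 0 < 1 - Cmod z) by lra.
  exists (mkposreal _ Hp). intros y Hy. change (Cmod (y - z) < 1 - Cmod z) in Hy.
  replace y with (z + (y - z))%C by ring. eapply Rle_lt_trans; [apply Cmod_triangle|lra].
Qed.

Lemma continuous_on_disc (F : C -> C) (z : C) :
  @continuous_on C_UniformSpace C_UniformSpace unit_disc F -> unit_disc z ->
  @continuous C_UniformSpace C_UniformSpace F z.
Proof.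
  intros HF Hz P HP. specialize (HF z Hz P HP).
  change (@locally C_UniformSpace z (fun y => unit_disc y -> P (F y))) in HF.
  change (@locally C_UniformSpace z (fun y => P (F y))).
  generalize (filter_and _ _ HF (locally_unit_disc z Hz)).
  apply filter_imp. intros y [H1 H2]. exact (H1 H2).
Qed.

(** This is the form of properness that is used: a point whose image has modulus above [s] lies
    outside the closed disc of radius [r]. Around each point a gauge is chosen on which [|f|] stays
    away from 1, and compactness of the square containing the disc gives one lower bound for the
    gauges needed. *)
Lemma disc_compact_image (f : C -> C) (r : R) :
  @continuous_on C_UniformSpace C_UniformSpace unit_disc f ->
  (forall z, unit_disc z -> unit_disc (f z)) -> r < 1 ->
  exists s, s < 1 /\ forall z, Cmod z <= r -> Cmod (f z) <= s.
Proof.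
  intros Hf Hmap Hr.
  assert (Hdel : forall z : C, exists d : posreal, forall w : C, Cmod w <= r ->
     Rabs (Re w - Re z) < d -> Rabs (Im w - Im z) < d -> Cmod (f w) <= 1 - d).
  { intros z. destruct (Rle_lt_dec (Cmod z) r) as [Hz|Hz].
    - assert (Hzd : unit_disc z) by (unfold unit_disc; lra).
      pose proof (Hmap z Hzd) as Hfz. unfold unit_disc in Hfz.
      destruct (proj1 (continuous_C_iff_eps f z) (continuous_on_disc f z Hf Hzd) ((1 - Cmod (f z)) / 2)) as [d [Hd Hd']]; [lra|].
      assert (Hp : 0 < Rmin (d / 2) ((1 - Cmod (f z)) / 2)) by (apply Rmin_pos; lra).
      exists (mkposreal _ Hp). intros w _; cbn. intros H1 H2.
      pose proof (Rmin_l (d / 2) ((1 - Cmod (f z)) / 2)); pose proof (Rmin_r (d / 2) ((1 - Cmod (f z)) / 2)).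
      specialize (Hd' w). assert (H3 : Cmod (w - z) < d).
      { eapply Rle_lt_trans; [apply Cmod_le_Re_Im|].
        change (Rabs (Re w - Re z) + Rabs (Im w - Im z) < d). lra. }
      specialize (Hd' H3).
      replace (f w) with (f z + (f w - f z))%C by ring.
      eapply Rle_trans; [apply Cmod_triangle|]. lra.
    (* For a centre outside the closed disc the gauge is so small that no point of the disc falls
       within it, and the condition is vacuous. *)
    - assert (Hp : 0 < (Cmod z - r) / 2) by lra.
      exists (mkposreal _ Hp). intros w Hw; cbn. intros H1 H2. exfalso.
      assert (Cmod (z - w) < Cmod z - r).
      { eapply Rle_lt_trans; [apply Cmod_le_Re_Im|].
        change (Rabs (Re z - Re w) + Rabs (Im z - Im w) < Cmod z - r).
        rewrite (Rabs_minus_sym (Re z)), (Rabs_minus_sym (Im z)). lra. }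
      assert (Cmod z <= Cmod w + Cmod (z - w)).
      { replace z with (w + (z - w))%C at 1 by ring. apply Cmod_triangle. }
      lra. }
  destruct (functional_choice _ Hdel) as [del Hdel'].
  destruct (compactness_value_2d (-1) 1 (-1) 1 (fun u v => del (u, v))) as [d Hd].
  exists (1 - d). pose proof (cond_pos d). split; [lra|]. intros z Hz.
  pose proof (re_le_Cmod z) as H1. pose proof (im_le_Cmod z) as H2.
  assert (HR : -1 <= Re z <= 1) by (apply Rabs_le_between; lra).
  assert (HI : -1 <= Im z <= 1) by (apply Rabs_le_between; lra).
  destruct (NNPP _ (Hd (Re z) (Im z) HR HI)) as [u [v [_ [_ [Hu [Hv Hle]]]]]].
  specialize (Hdel' (u, v) z Hz Hu Hv). lra.
Qed.

Definition circle_pt (rho t : R) : C := (rho * cos t, rho * sin t).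

Lemma Cmod_circle_pt (rho t : R) : 0 <= rho -> Cmod (circle_pt rho t) = rho.
Proof.
  intros H. unfold Cmod, circle_pt; cbn [fst snd].
  replace ((rho * cos t) ^ 2 + (rho * sin t) ^ 2) with (rho ^ 2).
  - rewrite sqrt_pow2; lra.
  - pose proof (sin2_cos2 t) as E. unfold Rsqr in E.
    replace (rho ^ 2) with (rho ^ 2 * (sin t * sin t + cos t * cos t)) by (rewrite E; ring). ring.
Qed.

Lemma is_derive_circle_pt (rho t : R) :
  @is_derive R_AbsRing C_R_NormedModule (circle_pt rho) t (Ci * circle_pt rho t)%C.
Proof.
  apply is_derive_curve_components. unfold circle_pt, Re, Im; cbn. split.
  - auto_derive; [exact I|ring].
  - auto_derive; [exact I|ring].
Qed.

Lemma continuity_2d_circle_pt (F : C -> R) (rho t : R) :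
  @continuous C_UniformSpace R_UniformSpace F (circle_pt rho t) ->
  continuity_2d_pt (fun u s => F (circle_pt u s)) rho t.
Proof.
  intros HF. apply continuity_2d_pt_filterlim.
  apply (continuous_comp (V := C_UniformSpace) (fun z : R * R => circle_pt (fst z) (snd z)) F (rho, t)); [|exact HF].
  apply continuous_C_components. unfold circle_pt, Re, Im; cbn [fst snd]. split.
  - apply (@continuous_mult _ R_AbsRing (fun z : R * R => fst z) (fun z => cos (snd z))).
    + apply continuous_fst.
    + apply (continuous_comp (fun z : R * R => snd z) cos); [apply continuous_snd|apply continuous_cos].
  - apply (@continuous_mult _ R_AbsRing (fun z : R * R => fst z) (fun z => sin (snd z))).
    + apply continuous_fst.
    + apply (continuous_comp (fun z : R * R => snd z) sin); [apply continuous_snd|apply continuous_sin].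
Qed.

(** * Wirtinger derivatives *)

Lemma is_derive_harmonic_curve (f h g : C -> C) (c : R -> C) (t : R) (p q e : C) :
  (forall z, unit_disc z -> f z = h z + Cconj (g z))%C ->
  unit_disc (c t) ->
  @is_derive C_AbsRing C_NormedModule h (c t) p ->
  @is_derive C_AbsRing C_NormedModule g (c t) q ->
  @is_derive R_AbsRing C_R_NormedModule c t e ->
  @is_derive R_AbsRing C_R_NormedModule (fun s => f (c s)) t (p * e + Cconj (q * e))%C.
Proof.
  intros Hf Hz Hh Hg Hc.
  apply (@is_derive_ext_loc R_AbsRing C_R_NormedModule (fun s => h (c s) + Cconj (g (c s)))%C).
  - assert (L : locally t (fun s => unit_disc (c s)))
      by exact (@ex_derive_continuous R_AbsRing C_R_NormedModule c t (ex_intro _ e Hc)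
        unit_disc (locally_unit_disc _ Hz)).
    revert L. apply filter_imp. intros s Hs. symmetry. now apply Hf.
  - apply (@is_derive_plus R_AbsRing C_R_NormedModule (fun s => h (c s)) (fun s => Cconj (g (c s)))).
    + now apply is_derive_curve_comp.
    + apply is_derive_curve_conj. now apply is_derive_curve_comp.
Qed.

(** The chain rule along the horizontal and vertical lines through [z], of velocities 1 and [i],
    gives [f_x = p + conj q] and [f_y = i (p - conj q)]. *)
Lemma wirtinger_derivatives (f h g : C -> C) (z p q : C) :
  (forall z, unit_disc z -> f z = h z + Cconj (g z))%C ->
  unit_disc z ->
  @is_derive C_AbsRing C_NormedModule h z p ->
  @is_derive C_AbsRing C_NormedModule g z q ->
  d_z f z = p /\ d_zbar f z = Cconj q.
Proof.
  intros Hf Hz Hh Hg.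
  assert (Ez : z = (Re z, Im z)) by (destruct z; reflexivity).
  assert (Ex : Cdx f z = (p + Cconj q)%C).
  { assert (H := is_derive_harmonic_curve f h g (fun s => (s, Im z)) (Re z) p q 1 Hf).
    cbv beta in H. rewrite <- Ez in H. specialize (H Hz Hh Hg).
    destruct (proj1 (is_derive_curve_components _ _ _) (H ltac:(apply is_derive_curve_components; split;
      [exact (is_derive_id (K := R_AbsRing) (Re z))|exact (is_derive_const (K := R_AbsRing) (V := R_NormedModule) (Im z) (Re z))])))
      as [H1 H2].
    apply is_derive_unique in H1, H2. apply injective_projections;
      [etransitivity; [exact H1|]|etransitivity; [exact H2|]]; unfold Re, Im; cbn; ring. }
  assert (Ey : Cdy f z = (Ci * (p - Cconj q))%C).
  { assert (H := is_derive_harmonic_curve f h g (fun s => (Re z, s)) (Im z) p q Ci Hf).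
    cbv beta in H. rewrite <- Ez in H. specialize (H Hz Hh Hg).
    destruct (proj1 (is_derive_curve_components _ _ _) (H ltac:(apply is_derive_curve_components; split;
      [exact (is_derive_const (K := R_AbsRing) (V := R_NormedModule) (Re z) (Im z))|exact (is_derive_id (K := R_AbsRing) (Im z))])))
      as [H1 H2].
    apply is_derive_unique in H1, H2. apply injective_projections;
      [etransitivity; [exact H1|]|etransitivity; [exact H2|]]; unfold Re, Im; cbn; ring. }
  unfold d_z, d_zbar. rewrite Ex, Ey.
  assert (Ei : (Ci * Ci)%C = (- (1))%C) by (apply injective_projections; cbn; ring).
  split.
  - replace (p + Cconj q - Ci * (Ci * (p - Cconj q)))%C with (p + Cconj q - (Ci * Ci) * (p - Cconj q))%C by ring.
    rewrite Ei. field.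
  - replace (p + Cconj q + Ci * (Ci * (p - Cconj q)))%C with (p + Cconj q + (Ci * Ci) * (p - Cconj q))%C by ring.
    rewrite Ei. field.
Qed.

(** Here [P] and [Q] stand for [h(z)/z] and [g(z)/z]. Solving the equation for [v] gives
    [(|p|^2 - |q|^2) v / z = i E], so the sign of [Im (v / z)] is that of [Re E]. The part of [E]
    with the unimodular factor [zeta] is estimated by its modulus, which produces the two negative
    products. *)
Lemma angular_velocity_pos (p q P Q z v : C) :
  z <> 0 -> Cmod q < Cmod p ->
  (p * v + Cconj (q * v) = Ci * (z * P + Cconj (z * Q)))%C ->
  0 < Re (Cconj p * P) + Re (Cconj q * Q) - Cmod p * Cmod Q - Cmod q * Cmod P ->
  0 < Im (v / z).
Proof.
  intros Hz Hpq Hv HN.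
  assert (HJ : 0 < Cmod p ^ 2 - Cmod q ^ 2) by (pose proof (Cmod_ge_0 q); nra).
  set (zeta := (Cconj z / z)%C).
  set (E := (Cconj p * P + Cconj q * Q + Cconj (p * Q + q * P) * zeta)%C).
  assert (Hzeta : Cmod zeta = 1).
  { unfold zeta. rewrite Cmod_div, Cmod_conj by exact Hz. apply Cmod_gt_0 in Hz. field; lra. }
  assert (Hi : Cconj Ci = (- Ci)%C) by (apply injective_projections; cbn; ring).
  assert (HE : (RtoC (Cmod p ^ 2 - Cmod q ^ 2) * (v / z) = Ci * E)%C).
  { rewrite RtoC_minus, !Cmod2_conj.
    transitivity ((Cconj p * (p * v + Cconj (q * v)) - Cconj q * Cconj (p * v + Cconj (q * v))) / z)%C.
    - rewrite !Cplus_conj, !Cmult_conj, !Cconj_conj. field. exact Hz.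
    - rewrite Hv. unfold E, zeta. rewrite !Cmult_conj, !Cplus_conj, !Cmult_conj, !Cconj_conj, Hi.
      field. exact Hz. }
  assert (HIm : (Cmod p ^ 2 - Cmod q ^ 2) * Im (v / z) = Re E).
  { transitivity (Im (RtoC (Cmod p ^ 2 - Cmod q ^ 2) * (v / z))%C).
    - unfold Im; cbn; ring.
    - rewrite HE. unfold Im, Re; cbn; ring. }
  assert (HR : 0 < Re E).
  { assert (H : Rabs (Re (Cconj (p * Q + q * P) * zeta)) <= Cmod p * Cmod Q + Cmod q * Cmod P).
    { eapply Rle_trans; [apply re_le_Cmod|]. rewrite Cmod_mult, Hzeta, Cmod_conj, Rmult_1_r.
      eapply Rle_trans; [apply Cmod_triangle|]. rewrite !Cmod_mult. lra. }
    apply Rabs_le_between in H.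
    change (Re E) with (Re (Cconj p * P) + Re (Cconj q * Q) + Re (Cconj (p * Q + q * P) * zeta)). lra. }
  apply Rmult_lt_reg_l with (1 := HJ). lra.
Qed.

Lemma Re_conj_mul_ge (p0 p P : C) (eps : R) :
  0 <= eps -> Cmod (p - p0) <= eps -> Cmod (P - p0) <= eps ->
  Cmod p0 ^ 2 - 2 * eps * Cmod p0 - eps ^ 2 <= Re (Cconj p * P).
Proof.
  intros He H1 H2.
  assert (E : Re (Cconj p * P) = Cmod p0 ^ 2 + Re (Cconj p0 * (P - p0) + Cconj (p - p0) * p0 + Cconj (p - p0) * (P - p0))).
  { rewrite Cmod2_alt. unfold Re, Im; cbn; ring. }
  assert (H : Rabs (Re (Cconj p0 * (P - p0) + Cconj (p - p0) * p0 + Cconj (p - p0) * (P - p0)))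
    <= 2 * eps * Cmod p0 + eps ^ 2).
  { eapply Rle_trans; [apply re_le_Cmod|].
    eapply Rle_trans; [apply Cmod_triangle|].
    eapply Rle_trans; [apply Rplus_le_compat_r, Cmod_triangle|].
    rewrite !Cmod_mult, !Cmod_conj.
    pose proof (Cmod_ge_0 p0). pose proof (Cmod_ge_0 (p - p0)). pose proof (Cmod_ge_0 (P - p0)). nra. }
  apply Rabs_le_between in H. lra.
Qed.

(** At [p = P = p0] and [q = Q = q0] the form is [(|p0| - |q0|)^2]. Perturbing by [eps] costs at
    most [4 eps (|p0| + |q0|) + 4 eps^2], whence the smallness condition. *)
Lemma angular_form_pos_near (p0 q0 p q P Q : C) (eps : R) :
  0 <= eps <= 1 ->
  eps * (4 * (Cmod p0 + Cmod q0) + 4) < (Cmod p0 - Cmod q0) ^ 2 ->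
  Cmod (p - p0) <= eps -> Cmod (q - q0) <= eps ->
  Cmod (P - p0) <= eps -> Cmod (Q - q0) <= eps ->
  0 < Re (Cconj p * P) + Re (Cconj q * Q) - Cmod p * Cmod Q - Cmod q * Cmod P.
Proof.
  intros He Hs H1 H2 H3 H4.
  pose proof (Re_conj_mul_ge p0 p P eps ltac:(lra) H1 H3).
  pose proof (Re_conj_mul_ge q0 q Q eps ltac:(lra) H2 H4).
  assert (T : forall x y : C, Cmod (x - y) <= eps -> 0 <= Cmod x <= Cmod y + eps).
  { intros x y Hxy. split; [apply Cmod_ge_0|].
    replace x with (y + (x - y))%C by ring. eapply Rle_trans; [apply Cmod_triangle|lra]. }
  apply T in H1, H2, H3, H4.
  pose proof (Cmod_ge_0 p0); pose proof (Cmod_ge_0 q0).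
  assert (Cmod p * Cmod Q <= (Cmod p0 + eps) * (Cmod q0 + eps)) by (apply Rmult_le_compat; lra).
  assert (Cmod q * Cmod P <= (Cmod q0 + eps) * (Cmod p0 + eps)) by (apply Rmult_le_compat; lra).
  nra.
Qed.

(** As [z] tends to 0, [h'(z)] and [h(z)/z] have the common limit [h'(0)], and likewise for [g]. So
    the form of [angular_form_pos_near] is close to its positive value at the origin: preimages of
    small circles turn counterclockwise. *)
Lemma angular_velocity_pos_near_0 (h g : C -> C) :
  h 0 = 0 -> g 0 = 0 ->
  @is_derive C_AbsRing C_NormedModule h (RtoC 0) (C_derive h 0) ->
  @is_derive C_AbsRing C_NormedModule g (RtoC 0) (C_derive g 0) ->
  @continuous C_UniformSpace C_UniformSpace (C_derive h) (RtoC 0) ->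
  @continuous C_UniformSpace C_UniformSpace (C_derive g) (RtoC 0) ->
  Cmod (C_derive g 0) < Cmod (C_derive h 0) ->
  exists d, 0 < d /\ forall z v : C, z <> 0 -> Cmod z < d ->
    Cmod (C_derive g z) < Cmod (C_derive h z) ->
    (C_derive h z * v + Cconj (C_derive g z * v) = Ci * (h z + Cconj (g z)))%C ->
    0 < Im (v / z).
Proof.
  intros Hh0 Hg0 Hh Hg Ch Cg H.
  set (p0 := C_derive h 0) in *. set (q0 := C_derive g 0) in *.
  pose proof (Cmod_ge_0 q0) as Hq0.
  set (B := 4 * (Cmod p0 + Cmod q0) + 4). assert (HB : 0 < B) by (unfold B; lra).
  assert (Hm : 0 < (Cmod p0 - Cmod q0) ^ 2) by (apply pow_lt; lra).
  set (eps := Rmin 1 ((Cmod p0 - Cmod q0) ^ 2 / (2 * B))).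
  assert (He : 0 < eps) by (apply Rmin_pos; [lra|apply Rdiv_lt_0_compat; lra]).
  assert (He1 : eps <= 1) by apply Rmin_l.
  assert (He2 : eps * B < (Cmod p0 - Cmod q0) ^ 2).
  { apply Rle_lt_trans with ((Cmod p0 - Cmod q0) ^ 2 / (2 * B) * B).
    - apply Rmult_le_compat_r; [lra|apply Rmin_r].
    - replace ((Cmod p0 - Cmod q0) ^ 2 / (2 * B) * B) with ((Cmod p0 - Cmod q0) ^ 2 / 2) by (field; lra). lra. }
  destruct (proj1 (is_derive_C_iff _ _ _) Hh eps He) as [d1 [Hd1 D1]].
  destruct (proj1 (is_derive_C_iff _ _ _) Hg eps He) as [d2 [Hd2 D2]].
  destruct (proj1 (continuous_C_iff_eps _ _) Ch eps He) as [d3 [Hd3 D3]].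
  destruct (proj1 (continuous_C_iff_eps _ _) Cg eps He) as [d4 [Hd4 D4]].
  set (d := Rmin (Rmin d1 d2) (Rmin d3 d4)).
  assert (Hdl : d <= d1 /\ d <= d2 /\ d <= d3 /\ d <= d4).
  { pose proof (Rmin_l (Rmin d1 d2) (Rmin d3 d4)); pose proof (Rmin_r (Rmin d1 d2) (Rmin d3 d4)).
    pose proof (Rmin_l d1 d2); pose proof (Rmin_r d1 d2); pose proof (Rmin_l d3 d4); pose proof (Rmin_r d3 d4).
    unfold d; repeat split; lra. }
  exists d; split; [repeat apply Rmin_pos; assumption|].
  intros z v Hz Hzd Hpq Hv.
  assert (Ez : (z - 0)%C = z) by ring.
  specialize (D1 z); specialize (D2 z); specialize (D3 z); specialize (D4 z).
  rewrite ?Ez, ?Hh0, ?Hg0 in *.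
  assert (Hq : forall (u l : C), Cmod (u - 0 - z * l) <= eps * Cmod z -> Cmod (u / z - l) <= eps).
  { intros u l Hu. replace (u / z - l)%C with ((u - 0 - z * l) / z)%C by (field; exact Hz).
    rewrite Cmod_div by exact Hz. apply Cmod_gt_0 in Hz.
    apply Rmult_le_reg_r with (Cmod z); [exact Hz|]. unfold Rdiv.
    rewrite Rmult_assoc, Rinv_l by lra. lra. }
  apply (angular_velocity_pos (C_derive h z) (C_derive g z) (h z / z) (g z / z) z v Hz Hpq).
  - rewrite Hv. replace (z * (h z / z))%C with (h z) by (field; exact Hz).
    replace (z * (g z / z))%C with (g z) by (field; exact Hz). reflexivity.
  - apply (angular_form_pos_near p0 q0 _ _ _ _ eps); [lra|exact He2| | | |].
    + apply Rlt_le, D3; lra.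
    + apply Rlt_le, D4; lra.
    + apply Hq, D1; lra.
    + apply Hq, D2; lra.
Qed.

(** * Level curves *)

Lemma Cpseries_at_0 (c : nat -> C) (s : C) :
  c 0%nat = 0 -> is_Cpseries c 0 s -> s = 0.
Proof.
  intros H0 Hs. apply (is_Cseries_unique _ _ _ Hs).
  pose proof (is_Cpseries_monomial 0 0 0) as M.
  replace (0 * 0 ^ 0)%C with (RtoC 0) in M by ring.
  eapply is_series_ext; [|exact M].
  intros n. cbn beta. destruct (Nat.eq_dec n 0) as [->|Hn].
  - now rewrite H0.
  - destruct n as [|n]; [lia|]. rewrite Cpow_S.
    change (0 * (0 * 0 ^ n) = c (S n) * (0 * 0 ^ n))%C. ring.
Qed.

(** Cancelling [x + y] turns the condition into [x + y <= K (x - y)]. The factor [x - y] is the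
    least stretching of [df], so [|h' v|] and [|g' v|] will be at most [K |df(v)|]. *)
Lemma quasiregular_bounds (K x y : R) :
  0 <= x -> 0 <= y -> 0 < x ^ 2 - y ^ 2 -> (x + y) ^ 2 <= K * (x ^ 2 - y ^ 2) ->
  y < x /\ x <= K * (x - y) /\ y <= K * (x - y).
Proof.
  intros Hx Hy HJ HK. assert (Hlt : y < x) by nra.
  assert (x + y <= K * (x - y)).
  { apply Rmult_le_reg_r with (x + y); [lra|]. nra. }
  repeat split; lra.
Qed.

(* The preimages [gam] of the circles [|w| = rho] under [f], for [rho] close to [1],
   with [theta] a continuous determination of their argument. *)
Lemma level_curve_exists (K : R) (f h g : C -> C) (a b : nat -> C) (r : R) :
  (forall z, unit_disc z -> is_Cpseries a z (h z)) ->
  (forall z, unit_disc z -> is_Cpseries b z (g z)) ->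
  a 0%nat = 0 -> b 0%nat = 0 ->
  (forall z, unit_disc z -> f z = h z + Cconj (g z))%C ->
  homeomorphism_onto unit_disc unit_disc f ->
  (forall z, unit_disc z -> Cmod (C_derive g z) < Cmod (C_derive h z) /\
     Cmod (C_derive h z) <= K * (Cmod (C_derive h z) - Cmod (C_derive g z)) /\
     Cmod (C_derive g z) <= K * (Cmod (C_derive h z) - Cmod (C_derive g z))) ->
  0 < r < 1 -> 0 <= K ->
  exists (gam v : R -> C) (theta : R -> R),
    (forall t, 0 <= t <= 2 * PI ->
       r <= Cmod (gam t) < 1 /\
       @is_derive R_AbsRing C_R_NormedModule gam t (v t) /\
       is_derive theta t (Im (v t / gam t)) /\
       Cmod (C_derive h (gam t) * v t + Cconj (C_derive g (gam t) * v t)) <= 1 /\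
       Cmod (C_derive h (gam t) * v t) <= K /\
       Cmod (C_derive g (gam t) * v t) <= K) /\
    gam (2 * PI) = gam 0 /\
    2 * PI <= theta (2 * PI) - theta 0.
Proof.
  intros Hh Hg Ha0 Hb0 Hf [Hmap [Hfc [k [Hk [Hkc [Hkf Hfk]]]]]] Hpq Hr HK.
  assert (H0d : unit_disc 0) by (unfold unit_disc; rewrite Cmod_0; lra).
  assert (Eh : h 0 = 0) by exact (Cpseries_at_0 a _ Ha0 (Hh _ H0d)).
  assert (Eg : g 0 = 0) by exact (Cpseries_at_0 b _ Hb0 (Hg _ H0d)).
  assert (Ef : f 0 = 0) by (rewrite Hf, Eh, Eg, Cconj_R by exact H0d; ring).
  assert (Ek : k 0 = 0) by (rewrite <- Ef at 1; now apply Hkf).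
  assert (Dh : forall z, unit_disc z -> @is_derive C_AbsRing C_NormedModule h z (C_derive h z))
    by (intros z Hz; now apply (Cpseries_derive a h Hh z Hz)).
  assert (Dg : forall z, unit_disc z -> @is_derive C_AbsRing C_NormedModule g z (C_derive g z))
    by (intros z Hz; now apply (Cpseries_derive b g Hg z Hz)).
  assert (Kc : forall w, unit_disc w -> @continuous C_UniformSpace C_UniformSpace k w)
    by (intros w Hw; now apply continuous_on_disc).
  set (p := fun w => C_derive h (k w)). set (q := fun w => C_derive g (k w)).
  assert (Pc : forall w, unit_disc w -> @continuous C_UniformSpace C_UniformSpace p w).
  { intros w Hw. apply (continuous_comp (V := C_UniformSpace) k (C_derive h)); [now apply Kc|].
    apply (continuous_C_derive_Cpseries a); [exact Hh|now apply Hk]. }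
  assert (Qc : forall w, unit_disc w -> @continuous C_UniformSpace C_UniformSpace q w).
  { intros w Hw. apply (continuous_comp (V := C_UniformSpace) k (C_derive g)); [now apply Kc|].
    apply (continuous_C_derive_Cpseries b); [exact Hg|now apply Hk]. }
  (* [V w] is the velocity of the preimage curve at [k w]: the vector that [df] sends to [i w], the
     velocity of the circle through [w]. *)
  set (V := fun w => ((Cconj (p w) * (Ci * w) - Cconj (q w) * Cconj (Ci * w))
     / RtoC (Cmod (p w) ^ 2 - Cmod (q w) ^ 2))%C).
  assert (HV : forall w, unit_disc w -> (p w * V w + Cconj (q w * V w))%C = (Ci * w)%C).
  { intros w Hw. apply wirtinger_solve. apply Hpq, Hk, Hw. }
  assert (Vc : forall w, unit_disc w -> @continuous C_UniformSpace C_UniformSpace V w).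
  { intros w Hw.
    assert (Ic : @continuous C_UniformSpace C_UniformSpace (fun w => Ci * w)%C w).
    { apply continuous_Cmult; [apply continuous_const|apply continuous_id]. }
    apply continuous_Cmult.
    - apply continuous_Cminus; apply continuous_Cmult; repeat apply continuous_Cconj; auto.
    - apply continuous_Cinv.
      + intros E. apply RtoC_inj in E. pose proof (Hpq (k w) (Hk w Hw)) as [H1 _].
        fold (p w) (q w) in H1. pose proof (Cmod_ge_0 (q w)). nra.
      + apply (continuous_ext (T := C_UniformSpace) (U := C_UniformSpace)
          (fun w => p w * Cconj (p w) - q w * Cconj (q w))%C).
        * intros u. now rewrite RtoC_minus, !Cmod2_conj.
        * apply continuous_Cminus; apply continuous_Cmult; try apply continuous_Cconj; auto. }
  assert (Kne : forall w, unit_disc w -> w <> 0 -> k w <> 0).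
  { intros w Hw Hne E. apply Hne. rewrite <- (Hfk w Hw), E. exact Ef. }
  (* The angular velocity about 0 of the preimage curve; its integral from 0 serves as [theta]. *)
  set (G := fun rho t => Im (V (circle_pt rho t) / k (circle_pt rho t))).
  assert (Hcd : forall rho t, 0 < rho < 1 -> unit_disc (circle_pt rho t) /\ circle_pt rho t <> 0).
  { intros rho t Hrho. unfold unit_disc. split; [|apply Cmod_gt_0]; rewrite Cmod_circle_pt; lra. }
  assert (HG : forall rho t, 0 < rho < 1 -> continuity_2d_pt G rho t).
  { intros rho t Hrho. destruct (Hcd rho t Hrho) as [Hw Hne].
    apply (continuity_2d_circle_pt (fun w => Im (V w / k w))).
    assert (Hc : @continuous C_UniformSpace C_UniformSpace (fun w => V w / k w)%C (circle_pt rho t)).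
    { apply continuous_Cmult; [now apply Vc|]. apply continuous_Cinv; [now apply Kne|now apply Kc]. }
    now apply continuous_C_components in Hc. }
  assert (Hgam : forall rho t, 0 < rho < 1 ->
    @is_derive R_AbsRing C_R_NormedModule (fun s => k (circle_pt rho s)) t (V (circle_pt rho t))).
  { intros rho t Hrho. destruct (Hcd rho t Hrho) as [Hw Hne].
    apply (is_derive_curve_inverse h g (fun s => k (circle_pt rho s)) (circle_pt rho) t
      (p (circle_pt rho t)) (q (circle_pt rho t)) _ (Ci * circle_pt rho t)%C).
    - apply Dh, Hk, Hw.
    - apply Dg, Hk, Hw.
    - apply Hpq, Hk, Hw.
    - intros s. destruct (Hcd rho s Hrho) as [Hs _]. rewrite <- Hf by now apply Hk. symmetry; now apply Hfk.
    - apply is_derive_circle_pt.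
    - intros eps Heps.
      destruct (proj1 (continuous_C_iff_eps _ _) (Kc _ Hw) eps Heps) as [d [Hd Hd']].
      assert (L := @ex_derive_continuous R_AbsRing C_R_NormedModule _ t
        (ex_intro _ _ (is_derive_circle_pt rho t)) (fun z => Cmod (z - circle_pt rho t) < d)).
      destruct L as [d' Hd''].
      + apply locally_C. exists (mkposreal d Hd). intros y Hy; exact Hy.
      + exists d'; split; [apply cond_pos|]. intros s Hs. apply Hd'. exact (Hd'' s Hs).
    - now apply HV. }
  assert (Hth : forall rho t, 0 < rho < 1 -> is_derive (fun s => RInt (G rho) 0 s) t (G rho t)).
  { intros rho t Hrho.
    apply (is_derive_RInt (V := R_NormedModule) (G rho) (fun s => RInt (G rho) 0 s) 0 t).
    - apply filter_forall. intros s. apply (@RInt_correct R_CompleteNormedModule).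
      apply (@ex_RInt_continuous R_CompleteNormedModule). intros u _.
      now apply continuity_2d_pt_snd, HG.
    - now apply continuity_2d_pt_snd, HG. }
  pose proof PI_RGT_0 as HPI.
  assert (Hper : forall rho, circle_pt rho (2 * PI) = circle_pt rho 0).
  { intros rho. unfold circle_pt. now rewrite cos_2PI, sin_2PI, cos_0, sin_0. }
  assert (Hwind : forall rho, 0 < rho < 1 -> 2 * PI <= RInt (G rho) 0 (2 * PI)).
  { apply winding_ge_2PI; [exact HG| |].
    - intros rho Hrho.
      apply (closed_curve_cos_lift (fun t => k (circle_pt rho t)) (fun t => V (circle_pt rho t))
        (fun s => RInt (G rho) 0 s) (2 * PI)); [lra| | |].
      + intros t _. destruct (Hcd rho t Hrho) as [Hw Hne].
        split; [now apply Kne|]. split; [now apply Hgam|now apply Hth].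
      + cbv beta. now rewrite Hper.
      + apply (@RInt_point R_CompleteNormedModule).
    - destruct (angular_velocity_pos_near_0 h g Eh Eg (Dh _ H0d) (Dg _ H0d)
        (continuous_C_derive_Cpseries a h _ Hh H0d) (continuous_C_derive_Cpseries b g _ Hg H0d)
        (proj1 (Hpq _ H0d))) as [d [Hd Hpos]].
      destruct (proj1 (continuous_C_iff_eps _ _) (Kc _ H0d) d Hd) as [d' [Hd' Hk']].
      exists d'; split; [exact Hd'|]. intros rho t Hrho Hrho1.
      destruct (Hcd rho t ltac:(lra)) as [Hw Hne].
      apply Hpos; [now apply Kne| |apply Hpq, Hk, Hw|].
      + specialize (Hk' (circle_pt rho t)). rewrite Ek in Hk'.
        replace (k (circle_pt rho t)) with (k (circle_pt rho t) - 0)%C by ring.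
        apply Hk'. replace (circle_pt rho t - 0)%C with (circle_pt rho t) by ring.
        rewrite Cmod_circle_pt; lra.
      + rewrite <- Hf by now apply Hk. rewrite Hfk by exact Hw. now apply HV. }
  destruct (disc_compact_image f r Hfc Hmap ltac:(lra)) as [s [Hs Hsr]].
  (* With [rho] above [s], no point of the preimage of the circle lies in the closed disc of radius
     [r]. The maximum with 0 ensures [rho > 0], as [s] comes only with an upper bound. *)
  set (rho := (1 + Rmax s 0) / 2).
  assert (Hrho : 0 < rho < 1 /\ s < rho).
  { unfold rho. pose proof (Rmax_l s 0); pose proof (Rmax_r s 0).
    assert (Rmax s 0 < 1) by (apply Rmax_lub_lt; lra). lra. }
  destruct Hrho as [Hrho Hsrho].
  exists (fun t => k (circle_pt rho t)), (fun t => V (circle_pt rho t)), (fun t => RInt (G rho) 0 t).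
  split; [|split].
  - intros t _. destruct (Hcd rho t Hrho) as [Hw Hne].
    assert (HVb : Cmod (p (circle_pt rho t) * V (circle_pt rho t) + Cconj (q (circle_pt rho t) * V (circle_pt rho t))) <= 1).
    { rewrite HV, Cmod_mult, Cmod_Ci, Cmod_circle_pt by (assumption || lra). lra. }
    split; [split|split; [|split; [|split; [|split]]]].
    + apply Rnot_lt_le. intros Hlt. specialize (Hsr (k (circle_pt rho t)) ltac:(lra)).
      rewrite Hfk, Cmod_circle_pt in Hsr by (assumption || lra). lra.
    + apply Hk, Hw.
    + now apply Hgam.
    + now apply Hth.
    + exact HVb.
    + destruct (Hpq _ (Hk _ Hw)) as [_ [H1 _]]. fold (p (circle_pt rho t)) (q (circle_pt rho t)) in *.
      pose proof (Cmod_wirtinger_ge (p (circle_pt rho t)) (q (circle_pt rho t)) (V (circle_pt rho t))).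
      rewrite Cmod_mult. pose proof (Cmod_ge_0 (V (circle_pt rho t))).
      apply Rle_trans with (K * (Cmod (p (circle_pt rho t)) - Cmod (q (circle_pt rho t))) * Cmod (V (circle_pt rho t))); [now apply Rmult_le_compat_r|].
      rewrite Rmult_assoc. rewrite <- (Rmult_1_r K) at 2. apply Rmult_le_compat_l; lra.
    + destruct (Hpq _ (Hk _ Hw)) as [_ [_ H1]]. fold (p (circle_pt rho t)) (q (circle_pt rho t)) in *.
      pose proof (Cmod_wirtinger_ge (p (circle_pt rho t)) (q (circle_pt rho t)) (V (circle_pt rho t))).
      rewrite Cmod_mult. pose proof (Cmod_ge_0 (V (circle_pt rho t))).
      apply Rle_trans with (K * (Cmod (p (circle_pt rho t)) - Cmod (q (circle_pt rho t))) * Cmod (V (circle_pt rho t))); [now apply Rmult_le_compat_r|].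
      rewrite Rmult_assoc. rewrite <- (Rmult_1_r K) at 2. apply Rmult_le_compat_l; lra.
  - cbv beta. now rewrite Hper.
  - cbv beta. rewrite (@RInt_point R_CompleteNormedModule).
    change (2 * PI <= RInt (G rho) 0 (2 * PI) - 0). specialize (Hwind rho Hrho). lra.
Qed.

(** * The limit as the radius tends to 1, and the conclusion *)

Lemma one_sub_pow_le (r : R) (n : nat) : 0 <= r <= 1 -> 1 - r ^ n <= INR n * (1 - r).
Proof.
  intros Hr. induction n as [|n IH].
  - cbn; lra.
  - rewrite S_INR. cbn [pow]. assert (0 <= r ^ n <= 1).
    { split; [apply pow_le; lra|]. rewrite <- (pow1 n). apply pow_incr; lra. }
    nra.
Qed.

(** With [y = r^n], multiplying the bound by [y] gives [X - 1 <= (1 - y) (X + 2 K)]. For [r = 1 - e]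
    Bernoulli's inequality makes the right side at most [e D], and [e] is chosen so that this is at
    most [(X - 1) / 2]. *)
Lemma le_1_of_radial_bound (X K : R) (n : nat) :
  0 <= X -> 0 <= K ->
  (forall r, 0 < r < 1 -> X <= (1 + K * (1 - r ^ (2 * n))) / r ^ n) -> X <= 1.
Proof.
  intros HX HK H. apply Rnot_lt_le; intros Hlt.
  pose proof (pos_INR n) as Hn.
  set (D := (INR n + 1) * (X + 2 * K)). assert (HD : 0 < D) by (unfold D; nra).
  set (e := Rmin (1 / 2) ((X - 1) / (2 * D))).
  assert (He : 0 < e) by (apply Rmin_pos; [lra|apply Rdiv_lt_0_compat; lra]).
  assert (He1 : e <= 1 / 2) by apply Rmin_l.
  assert (He2 : e * D <= (X - 1) / 2).
  { apply Rle_trans with ((X - 1) / (2 * D) * D); [apply Rmult_le_compat_r; [lra|apply Rmin_r]|].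
    right; field; lra. }
  specialize (H (1 - e) ltac:(lra)).
  pose proof (one_sub_pow_le (1 - e) n ltac:(lra)) as Hy.
  rewrite Nat.mul_comm, pow_mult in H.
  assert (Hy0 : 0 < (1 - e) ^ n <= 1).
  { split; [apply pow_lt; lra|]. apply Rle_trans with (1 ^ n); [apply pow_incr; lra|rewrite pow1; lra]. }
  set (y := (1 - e) ^ n) in *.
  apply Rmult_le_compat_r with (r := y) in H; [|lra].
  unfold Rdiv in H. rewrite Rmult_assoc, Rinv_l in H by lra.
  assert (H0 : K * (1 - y ^ 2) <= K * (2 * (1 - y))) by (apply Rmult_le_compat_l; nra).
  assert (H1 : X - 1 <= (1 - y) * (X + 2 * K)) by lra.
  assert (H2 : (1 - y) * (X + 2 * K) <= e * D).
  { unfold D. rewrite <- Rmult_assoc. apply Rmult_le_compat_r; nra. }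
  lra.
Qed.

Lemma Rpower_ge_1 (x y : R) : 1 <= x -> 0 <= y -> 1 <= Rpower x y.
Proof. intros Hx Hy. rewrite <- (Rpower_O x) by lra. now apply Rle_Rpower. Qed.

Theorem theorem2p8 (K : R) (f h g : C -> C) (a b : nat -> C) :
  1 <= K ->
  quasiconformal_harmonic K unit_disc unit_disc f ->
  analytic_on unit_disc h ->
  analytic_on unit_disc g ->
  (forall z : C, unit_disc z -> f z = (h z + Cconj (g z))%C) ->
  (forall z : C, unit_disc z ->
     @is_series C_AbsRing C_NormedModule (fun k : nat => (a (S k) * Cpow z (S k))%C) (h z)) ->
  (forall z : C, unit_disc z ->
     @is_series C_AbsRing C_NormedModule (fun k : nat => (b (S k) * Cpow z (S k))%C) (g z)) ->
  forall n : nat, (1 <= n)%nat ->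
    Cmod (a n) <= Rpower K (3 * K) * Rpower 2 (5 * (K - / K) / 2) / INR n /\
    Cmod (b n) <= Rpower K (3 * K) * Rpower 2 (5 * (K - / K) / 2) / INR n.
Proof.
  intros HK [[_ [HJ HQ]] Hhomeo] _ _ Hf Ha Hb n Hn.
  set (a' := fun m => if Nat.eq_dec m 0 then RtoC 0 else a m).
  set (b' := fun m => if Nat.eq_dec m 0 then RtoC 0 else b m).
  assert (Hh : forall z, unit_disc z -> is_Cpseries a' z (h z))
    by (intros z Hz; now apply Cpseries_zero_extend, Ha).
  assert (Hg : forall z, unit_disc z -> is_Cpseries b' z (g z))
    by (intros z Hz; now apply Cpseries_zero_extend, Hb).
  assert (Hpq : forall z, unit_disc z -> Cmod (C_derive g z) < Cmod (C_derive h z) /\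
     Cmod (C_derive h z) <= K * (Cmod (C_derive h z) - Cmod (C_derive g z)) /\
     Cmod (C_derive g z) <= K * (Cmod (C_derive h z) - Cmod (C_derive g z))).
  { intros z Hz.
    destruct (wirtinger_derivatives f h g z _ _ Hf Hz (proj1 (Cpseries_derive a' h Hh z Hz))
      (proj1 (Cpseries_derive b' g Hg z Hz))) as [E1 E2].
    specialize (HJ z Hz). specialize (HQ z Hz).
    unfold Jacobian, Lambda in *. rewrite E1, E2, Cmod_conj in *.
    apply quasiregular_bounds; try apply Cmod_ge_0; assumption. }
  assert (Hbound : INR n * Cmod (a' n) <= 1 /\ INR n * Cmod (b' n) <= 1).
  { split; apply (le_1_of_radial_bound _ K n); try lra;
      try (apply Rmult_le_pos; [apply pos_INR|apply Cmod_ge_0]);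
      intros r Hr;
      destruct (level_curve_exists K f h g a' b' r Hh Hg eq_refl eq_refl Hf Hhomeo Hpq Hr ltac:(lra))
        as [gam [v [theta [H [Hclosed Hwind]]]]].
    - apply (coefficient_estimate h g a' b' gam v theta n K r Hn Hh Hg (proj1 Hr)); [|exact Hclosed|exact Hwind].
      intros t Ht. destruct (H t Ht) as [H1 [H2 [H3 [H4 [H5 H6]]]]].
      exact (conj H1 (conj H2 (conj H3 (conj H4 H6)))).
    - apply (coefficient_estimate g h b' a' gam v theta n K r Hn Hg Hh (proj1 Hr)); [|exact Hclosed|exact Hwind].
      intros t Ht. destruct (H t Ht) as [H1 [H2 [H3 [H4 [H5 H6]]]]].
      split; [exact H1|]. split; [exact H2|]. split; [exact H3|]. split; [|exact H5].
      (* Conjugating [h' v + conj (g' v)] exchanges the two functions without changing the modulus,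
         so the same curve serves for [b]. *)
      rewrite <- Cmod_conj, Cplus_conj, Cconj_conj, Cplus_comm. exact H4. }
  assert (HnR : 0 < INR n) by (apply lt_0_INR; lia).
  assert (Hconst : 1 <= Rpower K (3 * K) * Rpower 2 (5 * (K - / K) / 2)).
  { assert (H1 := Rpower_ge_1 K (3 * K) HK ltac:(lra)).
    assert (HiK : / K <= / 1) by (apply Rinv_le_contravar; lra). rewrite Rinv_1 in HiK.
    assert (H2 := Rpower_ge_1 2 (5 * (K - / K) / 2) ltac:(lra) ltac:(lra)). nra. }
  unfold a', b' in Hbound. destruct (Nat.eq_dec n 0) as [E|_]; [lia|].
  split; apply Rmult_le_reg_l with (INR n); try exact HnR;
    (eapply Rle_trans; [apply Hbound|]);
    replace (INR n * (Rpower K (3 * K) * Rpower 2 (5 * (K - / K) / 2) / INR n))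
      with (Rpower K (3 * K) * Rpower 2 (5 * (K - / K) / 2)) by (field; lra); exact Hconst.
Qed.
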